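(* Let $k$ be a commutative ring and let $A$ be an associative, unital $k$-algebra. Then $$HS_*(A) = H_*\left(\mathscr{Y}_*^+A;\,k\right),$$ where $\mathscr{Y}_*^+A = k[N(-\setminus \Delta S_+)]\otimes_{\Delta S_+} B_*^{sym_+}A$.
   Context: Put $[n]=\{0,1,\dots,n\}$. The category $\Delta S$ has objects $[n]$, $n\ge 0$; a morphism $\alpha:[n]\to[m]$ is a set map together with a total ordering on each fiber $\alpha^{-1}(j)$, $j\in[m]$. Composition: for $\alpha:[n]\to[m]$, $\beta:[m]\to[p]$, the set map is $\beta\alpha$, and in the fiber over $j$ one has $i_1<i_2$ iff either $\alpha(i_1)<\alpha(i_2)$ in the ordering of $\beta^{-1}(j)$, or $\alpha(i_1)=\alpha(i_2)$ and $i_1<i_2$ in the ordering of that fiber of $\alpha$. The category $\Delta S_+$ is $\Delta S$ with an additional object $[-1]=\emptyset$ and a unique morphism $\iota_n:[-1]\to[n]$ for each $n\ge -1$ (there are no morphisms $[n]\to[-1]$ for $n\geq 0$). $B_*^{sym}A:\Delta S\to k\text{-}\mathbf{Mod}$ is the functor $[n]\mapsto A^{\otimes(n+1)}$ with $\alpha:[n]\to[m]$ sending $a_0\otimes\dots\otimes a_n$ to $b_0\otimes\dots\otimes b_m$, where $b_j$ is the product of the $a_i$, $i\in\alpha^{-1}(j)$, in the given order ($b_j=1_A$ if the fiber is empty). $B_*^{sym_+}A:\Delta S_+\to k\text{-}\mathbf{Mod}$ extends it by $[-1]\mapsto k$, $\iota_n:\lambda\mapsto \lambda(1_A\otimes\dots\otimes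 1_A)$. For a small category $\mathscr C$, a contravariant functor $M$ and a covariant functor $N$ from $\mathscr C$ to $k$-modules, $M\otimes_{\mathscr C}N=\bigoplus_X M(X)\otimes_k N(X)$ modulo $y\otimes f_*(x)\approx f^*(y)\otimes x$; $\mathrm{Tor}^{\mathscr C}_*$ denotes its derived functors. The symmetric homology of $A$ is $HS_*(A)=\mathrm{Tor}_*^{\Delta S}(\underline{k},B_*^{sym}A)$, with $\underline{k}$ the constant contravariant functor with value $k$. For an object $C$ of $\mathscr C$, $C\setminus\mathscr C$ is the under-category (objects: morphisms out of $C$); $N(-\setminus\mathscr C)$ is its nerve, a contravariant functor of $C$ with values in simplicial sets, and $k[N(-\setminus \mathscr C)]$ is the $k$-linearization, a simplicial contravariant $\mathscr C$-module. A simplicial $k$-module is regarded as a chain complex with differential the alternating sum of the face maps. *)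

(* Defs.v *)
From HB Require Import structures.
From mathcomp Require Import all_boot all_order all_algebra.
From mathcomp Require Import finmap boolp classical_sets functions cardinality fsbigop.

Set Implicit Arguments.
Unset Strict Implicit.
Unset Printing Implicit Defensive.

Import GRing.Theory.
Local Open Scope ring_scope.

Local Obligation Tactic := idtac.

(* The library's [algType k] requires 1 != 0; the record below also covers the
   zero ring, both for [k] and for the algebra. *)
Record kalgebra (k : comPzRingType) := KAlgebra {
  kalg_ring :> pzRingType;
  kalg_unit : {rmorphism k -> kalg_ring};
  kalg_unitC : forall c a, kalg_unit c * a = a * kalg_unit c }.

Fact in_algC (k : comPzRingType) (A : algType k) (c : k) (a : A) :
  in_alg A c * a = a * in_alg A c.
Proof. by rewrite /= mulr_algl mulr_algr. Qed.
Definition kalgebra_of_algType (k : comPzRingType) (A : algType k) :=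
  KAlgebra (@in_algC k A).

Definition lmod_iso (k : pzRingType) (U V : lmodType k) : Prop :=
  exists f : {linear U -> V}, bijective f.

Section Quotmod.
Variables (k : pzRingType) (V : lmodType k) (S : set V).

(* the submodule of V generated by S *)
Definition submod_span : {pred V} := fun v =>
  `[< forall W : set V, W 0 -> (forall a x y, W x -> W y -> W (a *: x + y)) ->
      (forall x, S x -> W x) -> W v >].

Fact submod_span_closed : submod_closed submod_span.
Proof.
split=> [|a x y /asboolP Wx /asboolP Wy]; apply/asboolP => W W0 WL WS //.
exact: (WL _ _ _ (Wx W W0 WL WS) (Wy W W0 WL WS)).
Qed.
HB.instance Definition _ := GRing.isSubmodClosed.Build k V submod_span submod_span_closed.

Lemma mem_submod_span x : S x -> x \in submod_span.
Proof. by move=> Sx; apply/asboolP => W _ _; apply. Qed.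

(* V / <S> *)
Definition quotmod := Quotient.quot submod_span.
HB.instance Definition _ := GRing.Zmodule.on quotmod.

Definition qpi (v : V) : quotmod := (\pi_quotmod v)%qT.
Definition qrepr (u : quotmod) : V := repr u.

Lemma qreprK : cancel qrepr qpi.
Proof. exact: reprK. Qed.

Lemma qpi_eq u v : (qpi u == qpi v) = (u - v \in submod_span).
Proof. by rewrite -Quotient.idealrBE. Qed.

Lemma qpiD : {morph qpi : u v / u + v}.
Proof. by move=> u v; rewrite /qpi Quotient.pi_add. Qed.

Definition qscale (a : k) (u : quotmod) : quotmod := qpi (a *: qrepr u).

Lemma qpi_scale a v : qscale a (qpi v) = qpi (a *: v).
Proof.
apply/eqP; rewrite qpi_eq -scalerBr rpredZ //.
by rewrite -qpi_eq qreprK.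
Qed.

Let ind (P : quotmod -> Prop) : (forall v, P (qpi v)) -> forall u, P u.
Proof. by move=> h u; rewrite -(qreprK u). Qed.

Fact qscalerA a b v : qscale a (qscale b v) = qscale (a * b) v.
Proof. by elim/ind: v => v; rewrite !qpi_scale scalerA. Qed.
Fact qscale1r : left_id 1 qscale.
Proof. by elim/ind => v; rewrite qpi_scale scale1r. Qed.
Fact qscalerDr : right_distributive qscale +%R.
Proof.
by move=> a; elim/ind=> u; elim/ind=> v; rewrite -qpiD !qpi_scale scalerDr qpiD.
Qed.
Fact qscalerDl v : {morph qscale^~ v : a b / a + b}.
Proof. by elim/ind: v => v a b; rewrite !qpi_scale scalerDl qpiD. Qed.
HB.instance Definition _ := GRing.Zmodule_isLmodule.Build k quotmod
  qscalerA qscale1r qscalerDr qscalerDl.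

Fact qpi_is_linear : linear qpi.
Proof. by move=> a u v; rewrite qpiD -qpi_scale. Qed.
HB.instance Definition _ := GRing.isLinear.Build k V quotmod *:%R qpi qpi_is_linear.

Section Lift.
Variables (W : lmodType k) (f : {linear V -> W}).
Hypothesis fS : forall x, S x -> f x = 0.

Lemma submod_span_lin0 x : x \in submod_span -> f x = 0.
Proof.
move=> /asboolP /(_ (fun x => f x = 0)); apply=> //; first exact: raddf0.
by move=> a u v fu fv; rewrite linearP fu fv scaler0 addr0.
Qed.

Definition qlift (u : quotmod) : W := f (qrepr u).

Lemma qliftE v : qlift (qpi v) = f v.
Proof.
apply/eqP; rewrite -subr_eq0 -raddfB /=; apply/eqP/submod_span_lin0.
by rewrite -qpi_eq qreprK.
Qed.

Fact qlift_is_linear : linear qlift.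
Proof.
move=> a; elim/ind=> u; elim/ind=> v.
by rewrite -linearP !qliftE linearP.
Qed.
Definition qlift_lin : {linear quotmod -> W} :=
  HB.pack qlift (GRing.isLinear.Build k quotmod W *:%R qlift qlift_is_linear).
End Lift.
End Quotmod.

Section Free.
Variables (k : pzRingType) (X : Type).

Definition fin_supp : {pred {classic X} -> k^o} := fun f =>
  `[< finite_set [set x | f x != 0] >].

Fact fin_supp_closed : submod_closed fin_supp.
Proof.
split=> [|a f g /asboolP ff /asboolP fg]; apply/asboolP.
  apply: (sub_finite_set (B := set0)) => // x /=.
  by rewrite eqxx.
apply: (sub_finite_set (B := [set x | f x != 0] `|` [set x | g x != 0])%classic).
  move=> x /=; have -> : (a *: f + g) x = a *: f x + g x by [].
  have [->|f0] := eqVneq (f x) 0; last by left.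
  by rewrite scaler0 add0r; right.
by rewrite finite_setU.
Qed.
HB.instance Definition _ :=
  GRing.isSubmodClosed.Build k ({classic X} -> k^o) fin_supp fin_supp_closed.

(* k[X]: finitely supported functions X -> k *)
Record freemod := FreeMod { fcoef :> {classic X} -> k^o; _ : fcoef \in fin_supp }.
HB.instance Definition _ := [isSub for fcoef].
HB.instance Definition _ := [Choice of freemod by <:].
HB.instance Definition _ := [SubChoice_isSubLmodule of freemod by <:].

Lemma fcoef_finite (f : freemod) : finite_set [set x | f x != 0].
Proof. by case: f => f /= /asboolP. Qed.

Lemma free_ext (f g : freemod) : (forall x, f x = g x) -> f = g.
Proof. by move=> fg; apply/val_inj/funext. Qed.

Fact fgen_subproof (x : {classic X}) :
  (fun y : {classic X} => (y == x)%:R : k^o) \in fin_supp.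
Proof.
apply/asboolP; apply: (sub_finite_set _ (finite_set1 x)) => y /=.
by have [->|] := eqVneq y x; rewrite ?eqxx.
Qed.
Definition fgen (x : X) : freemod := FreeMod (fgen_subproof x).

Definition fsupp (f : freemod) : {fset {classic X}} := fset_set [set x | f x != 0].
Lemma notin_fsupp (f : freemod) (x : {classic X}) : x \notin fsupp f -> f x = 0.
Proof.
rewrite in_fset_set; last exact: fcoef_finite.
by move=> /negP h; apply/eqP/negP => /negP fx; apply: h; rewrite inE.
Qed.

Section Flift.
Variables (W : lmodType k) (phi : X -> W).

Definition flift (f : freemod) : W :=
  \sum_(x \in [set: {classic X}]) (f x : k) *: phi x.

Lemma fliftE (f : freemod) (A : {fset {classic X}}) :
  (forall x, x \notin A -> f x = 0) -> flift f = \sum_(x <- A) (f x : k) *: phi x.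
Proof. by move=> Af; apply: fsbigTE => x /Af ->; rewrite scale0r. Qed.

Fact flift_is_linear : linear flift.
Proof.
move=> a f g; pose A : {fset {classic X}} := (fsupp f `|` fsupp g)%fset.
have fA (x : {classic X}) : x \notin A -> f x = 0.
  by rewrite inE negb_or => /andP[/notin_fsupp].
have gA (x : {classic X}) : x \notin A -> g x = 0.
  by rewrite inE negb_or => /andP[_ /notin_fsupp].
have E (x : {classic X}) : fcoef (a *: f + g) x = a * f x + g x by [].
rewrite (fliftE fA) (fliftE gA) (@fliftE _ A); last first.
  by move=> x xA; rewrite E fA // gA // mulr0 addr0.
rewrite scaler_sumr -big_split /=; apply: eq_bigr => x _.
by rewrite scalerA -scalerDl; congr (_ *: _).
Qed.
HB.instance Definition _ :=
  GRing.isLinear.Build k freemod W *:%R flift flift_is_linear.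

Lemma flift_gen x : flift (fgen x) = phi x.
Proof.
rewrite (@fliftE _ [fset (x : {classic X})]%fset) => [|y].
  by rewrite big_seq_fset1 /= eqxx scale1r.
by rewrite inE /= => /negPf ->.
Qed.
End Flift.

Lemma free_gen_sum (f : freemod) : flift fgen f = f.
Proof.
have ev_lin (y : {classic X}) : linear (fun f : freemod => fcoef f y : k^o) by [].
apply: free_ext => y.
pose ev : {linear freemod -> k^o} :=
  HB.pack (fun f : freemod => fcoef f y : k^o)
    (GRing.isLinear.Build k freemod k^o *:%R _ (ev_lin y)).
rewrite -[LHS]/(ev (flift fgen f)) (fliftE _ (@notin_fsupp f)) raddf_sum.
transitivity (\sum_(x <- fsupp f) (f x * (y == x)%:R)); first exact: eq_bigr.
have [yf|/[dup] yf /notin_fsupp fy] := boolP (y \in fsupp f).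
  rewrite (bigD1_seq y yf (fset_uniq _)) eqxx mulr1 big1 => [|x xy].
    exact: addr0.
  by rewrite eq_sym (negPf xy) mulr0.
rewrite fy big1_seq // => x /andP[_ xf].
by case: eqVneq => [yx|]; [rewrite yx xf in yf | rewrite mulr0].
Qed.

Lemma free_lin_ext (W : lmodType k) (g h : {linear freemod -> W}) :
  (forall x, g (fgen x) = h (fgen x)) -> g =1 h.
Proof.
move=> gh f; rewrite -(free_gen_sum f) /flift !raddf_sum /=.
by apply: eq_bigr => x _; rewrite !linearZ /= gh.
Qed.
End Free.

Record category := Category {
  ob :> Type;
  hom : ob -> ob -> Type;
  idm : forall x, hom x x;
  catcomp : forall x y z, hom y z -> hom x y -> hom x z;
  comp_idl : forall x y (f : hom x y), catcomp (idm y) f = f;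
  comp_idr : forall x y (f : hom x y), catcomp f (idm x) = f;
  compA : forall x y z t (h : hom z t) (g : hom y z) (f : hom x y),
    catcomp h (catcomp g f) = catcomp (catcomp h g) f }.
Notation "g '\oc' f" := (catcomp g f) (at level 40, left associativity).

Definition opposite (C : category) : category :=
  @Category C (fun x y => hom y x) (fun x => idm x)
    (fun x y z g f => f \oc g)
    (fun x y f => comp_idr f) (fun x y f => comp_idl f)
    (fun x y z t h g f => esym (compA f g h)).

Record cfunctor (C D : category) := CFunctor {
  cf_ob :> C -> D;
  cf_map : forall x y, hom x y -> hom (cf_ob x) (cf_ob y);
  cf_id : forall x, cf_map (idm x) = idm (cf_ob x);
  cf_comp : forall x y z (g : hom y z) (f : hom x y),
    cf_map (g \oc f) = cf_map g \oc cf_map f }.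

Section Modules.
Variable k : comPzRingType.

Record cmodule (C : category) := CModule {
  cm_ob :> C -> lmodType k;
  cm_map : forall x y, hom x y -> {linear cm_ob x -> cm_ob y};
  cm_id : forall x v, cm_map (idm x) v = v;
  cm_comp : forall x y z (g : hom y z) (f : hom x y) v,
    cm_map (g \oc f) v = cm_map g (cm_map f v) }.

(* contravariant functors from C to k-modules *)
Definition contra_cmodule (C : category) := cmodule (opposite C).

Record cmod_hom (C : category) (M N : cmodule C) := CModHom {
  nt :> forall x, {linear M x -> N x};
  nt_natural : forall x y (f : hom x y) v,
    nt y (cm_map M f v) = cm_map N f (nt x v) }.

Definition cmod_epi (C : category) (M N : cmodule C) (e : cmod_hom M N) :=
  forall x v, exists u, e x u = v.

(* Exactness in the category of C-modules is objectwise, so the epimorphisms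
   are the objectwise surjections. *)
Definition projective (C : category) (P : cmodule C) : Prop :=
  forall (M N : cmodule C) (e : cmod_hom M N) (f : cmod_hom P N), cmod_epi e ->
  exists g : cmod_hom P M, forall x v, e x (g x v) = f x v.

Record proj_resolution (C : category) (M : cmodule C) := ProjResolution {
  res_ob :> nat -> cmodule C;
  res_diff : forall n, cmod_hom (res_ob n.+1) (res_ob n);
  res_aug : cmod_hom (res_ob 0) M;
  res_proj : forall n, projective (res_ob n);
  res_aug_epi : cmod_epi res_aug;
  res_exact0 : forall x v,
    res_aug x v = 0 <-> exists u, res_diff 0 x u = v;
  res_exactS : forall n x v,
    res_diff n x v = 0 <-> exists u, res_diff n.+1 x u = v }.

Section Tensor.
Variable C : category.
Implicit Types (M : contra_cmodule C) (N : cmodule C).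

(* M (x)_C N is presented in one step: generators y (x) n with y in M(X) and n in
   N(X); the first four relations give the direct sum over X of the
   M(X) (x)_k N(X), the last one identifies y (x) f_*(n) with f^*(y) (x) n. *)
Definition tens_gen M N := {x : C & (M x * N x)%type}.

Definition egen M N (x : C) (y : M x) (n : N x) : freemod k (tens_gen M N) :=
  fgen k (existT (fun x : C => (M x * N x)%type) x (y, n)).

Inductive tens_rel M N : set (freemod k (tens_gen M N)) :=
| TensDl x (y y' : M x) (n : N x) :
    tens_rel (egen (y + y') n - egen y n - egen y' n)
| TensDr x (y : M x) (n n' : N x) :
    tens_rel (egen y (n + n') - egen y n - egen y n')
| TensZl x a (y : M x) (n : N x) :
    tens_rel (egen (a *: y) n - a *: egen y n)
| TensZr x a (y : M x) (n : N x) :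
    tens_rel (egen y (a *: n) - a *: egen y n)
| TensBal (x x' : C) (f : hom x x') (y : M x') (n : N x) :
    tens_rel (egen y (cm_map N f n) -
              egen (cm_map M (f : @hom (opposite C) x' x) y) n).

Definition tens M N : lmodType k := quotmod (@tens_rel M N).

Definition tensor M N (x : C) (y : M x) (n : N x) : tens M N :=
  qpi _ (egen y n).

Lemma tensor0l M N x (n : N x) : tensor (0 : M x) n = 0.
Proof.
rewrite /tensor -(raddf0 (qpi _)); apply/eqP; rewrite qpi_eq subr0.
by have := mem_submod_span (TensZl 0 (0 : M x) n); rewrite !scale0r subr0.
Qed.

Section TensMap.
Variables (M M' : contra_cmodule C) (h : cmod_hom M M') (N : cmodule C).

Definition tens_map_gen (g : tens_gen M N) : tens M' N :=
  tensor (h (tag g) (tagged g).1) (tagged g).2.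

Fact tens_map_subproof v : tens_rel v -> flift tens_map_gen v = 0 :> tens M' N.
Proof.
pose q : {linear _ -> _} := qpi (@tens_rel M' N).
pose L : {linear _ -> tens M' N} := flift tens_map_gen.
have E x (y : M x) (n : N x) : L (egen y n) = q (egen (h x y) n).
  exact: flift_gen.
have rel0 u : tens_rel u -> q u = 0.
  move=> /mem_submod_span ru; rewrite -(raddf0 q); apply/eqP.
  by rewrite [_ == _]qpi_eq subr0.
rewrite -[flift _ v]/(L v).
case=> {v} [x y y' n|x y n n'|x a y n|x a y n|x x' f y n].
- rewrite 2!(linearB L) !E -2!(linearB q); apply: rel0.
  by rewrite (linearD (h x)); apply: TensDl.
- by rewrite 2!(linearB L) !E -2!(linearB q); apply: rel0; apply: TensDr.
- rewrite (linearB L) (linearZ_LR L) !E -(linearZ_LR q) -(linearB q).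
  by apply: rel0; rewrite (linearZ_LR (h x)); apply: TensZl.
- rewrite (linearB L) (linearZ_LR L) !E -(linearZ_LR q) -(linearB q).
  by apply: rel0; apply: TensZr.
- rewrite (linearB L) !E -(linearB q); apply: rel0.
  by rewrite nt_natural; apply: TensBal.
Qed.

Definition tens_map : {linear tens M N -> tens M' N} :=
  qlift_lin tens_map_subproof.

Lemma tens_mapE x (y : M x) (n : N x) :
  tens_map (tensor y n) = tensor (h x y) n.
Proof.
rewrite -[LHS]/(qlift (flift tens_map_gen) (qpi _ (egen y n))).
by rewrite (qliftE (@tens_map_subproof)) /= flift_gen.
Qed.
End TensMap.

Lemma tens_lin_ext M N (W : lmodType k) (f g : {linear tens M N -> W}) :
  (forall x (y : M x) (n : N x), f (tensor y n) = g (tensor y n)) -> f =1 g.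
Proof.
move=> fg u; rewrite -(qreprK u); set v := qrepr u.
apply: (@free_lin_ext _ _ _ (f \o qpi _) (g \o qpi _)).
by case=> x [y n]; apply: fg.
Qed.
End Tensor.

Record chain_complex := ChainComplex {
  cc_ob :> nat -> lmodType k;
  cc_diff : forall n, {linear cc_ob n.+1 -> cc_ob n};
  cc_diffK : forall n x, cc_diff n (cc_diff n.+1 x) = 0 }.

Section Homology.
Variables (X : chain_complex) (n : nat).

Definition cyclep : {pred X n} :=
  match n return {pred X n} with
  | 0 => predT
  | m.+1 => fun x => cc_diff X m x == 0
  end.

Fact cyclep_closed : submod_closed cyclep.
Proof.
rewrite /cyclep; case: n => [|m]; split=> // [|a x y]; rewrite !unfold_in.
  by rewrite raddf0.
by move=> /eqP dx /eqP dy; rewrite linearP dx dy scaler0 addr0.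
Qed.
HB.instance Definition _ :=
  GRing.isSubmodClosed.Build k (X n) cyclep cyclep_closed.

Record cycles := Cycle { cycle_val :> X n; _ : cycle_val \in cyclep }.
HB.instance Definition _ := [isSub for cycle_val].
HB.instance Definition _ := [Choice of cycles by <:].
HB.instance Definition _ := [SubChoice_isSubLmodule of cycles by <:].

Definition homology : lmodType k :=
  quotmod (fun z : cycles => exists y, cc_diff X n y = cycle_val z).
End Homology.

Section TensComplex.
Variables (C : category) (M : contra_cmodule C) (N : cmodule C).
Variable P : proj_resolution M.

Fact tens_complexK n u :
  tens_map (res_diff P n) N (tens_map (res_diff P n.+1) N u) = 0.
Proof.
pose d := tens_map (res_diff P n) N; pose d' := tens_map (res_diff P n.+1) N.
have := @tens_lin_ext _ _ _ _ (d \o d') \0; apply=> x y v.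
rewrite -[LHS]/(tens_map (res_diff P n) N
  (tens_map (res_diff P n.+1) N (tensor y v))) !tens_mapE.
have -> : res_diff P n x (res_diff P n.+1 x y) = 0.
  by apply/res_exactS; exists y.
exact: tensor0l.
Qed.

Definition tens_complex : chain_complex :=
  @ChainComplex (fun n => tens (P n) N) (fun n => tens_map (res_diff P n) N)
    tens_complexK.
End TensComplex.

(* T is (isomorphic to) the n-th left derived functor of - (x)_C N at M: it is the
   homology of P (x)_C N for every projective resolution P of M.  The first
   conjunct asserts that resolutions exist, so that the second is not vacuous. *)
Definition is_Tor (C : category) (M : contra_cmodule C) (N : cmodule C)
    (n : nat) (T : lmodType k) : Prop :=
  (exists P : proj_resolution M, True) /\
  forall P : proj_resolution M, lmod_iso T (homology (tens_complex N P) n).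

(* Only the faces sm_face n i, i <= n.+1, are recorded (values at larger i are
   irrelevant): degeneracies do not enter the unnormalised chain complex. *)
Record simp_module := SimpModule {
  sm_ob :> nat -> lmodType k;
  sm_face : forall (n i : nat), {linear sm_ob n.+1 -> sm_ob n};
  sm_faceK : forall n i j x, (i < j <= n.+2)%N ->
    sm_face n i (sm_face n.+1 j x) = sm_face n j.-1 (sm_face n.+1 i x) }.

Section AltComplex.
Variable X : simp_module.

Definition alt_diff n (x : X n.+1) : X n :=
  \sum_(i < n.+2) (-1) ^+ i *: sm_face X n i x.

Fact alt_diff_linear n : linear (@alt_diff n).
Proof.
move=> a x y; rewrite /alt_diff scaler_sumr -big_split; apply: eq_bigr => i _.
by rewrite linearP /= scalerDr !scalerA mulrC.
Qed.
HB.instance Definition _ n :=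
  GRing.isLinear.Build k (X n.+1) (X n) *:%R (@alt_diff n) (@alt_diff_linear n).

Fact alt_diffK n (x : X n.+2) : alt_diff (alt_diff x) = 0.
Proof.
pose F (i j : nat) : X n :=
  (-1) ^+ (i + j) *: sm_face X n i (sm_face X n.+1 j x).
have FS i j : (i <= j <= n.+1)%N -> F i j.+1 = - F j i.
  move=> ij; rewrite /F sm_faceK //= addnS exprS -scalerA scaleN1r.
  by rewrite addnC.
transitivity (\sum_(i < n.+2) \sum_(j < n.+3) F i j).
  apply: eq_bigr => i _; rewrite linear_sum scaler_sumr; apply: eq_bigr => j _.
  by rewrite linearZ_LR scalerA -exprD.
transitivity (\sum_(i < n.+2) (\sum_(j < n.+3 | (i < j)%N) F i j +
                               \sum_(j < n.+3 | (j <= i)%N) F i j)).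
  apply: eq_bigr => i _; rewrite (bigID (fun j : 'I_n.+3 => (i < j)%N)) /=.
  by congr (_ + _); apply: eq_bigl => j; rewrite -leqNgt.
rewrite big_split /=.
have -> : \sum_(i < n.+2) \sum_(j < n.+3 | (i < j)%N) F i j =
          \sum_(i < n.+2) \sum_(j < n.+2 | (i <= j)%N) - F j i.
  apply: eq_bigr => i _; rewrite big_mkcond big_ord_recl /= add0r -big_mkcond /=.
  by apply: eq_bigr => j ij; apply: FS; apply/andP; split=> //; rewrite -ltnS ltn_ord.
have -> : \sum_(i < n.+2) \sum_(j < n.+3 | (j <= i)%N) F i j =
          \sum_(j < n.+2) \sum_(i < n.+2 | (j <= i)%N) F i j.
  rewrite (exchange_big_dep xpredT) //= big_ord_recr /=.
  by rewrite [X in _ + X]big1 ?addr0 // => i; rewrite leqNgt ltn_ord.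
rewrite -big_split big1 //= => i _.
by rewrite sumrN addNr.
Qed.

Definition alt_complex : chain_complex :=
  @ChainComplex X (fun n => @alt_diff n) alt_diffK.
End AltComplex.

End Modules.


Section Nerve.
Variable C : category.

(* strings x -> x_1 -> ... -> x_p of p composable arrows starting at x *)
Fixpoint string (p : nat) (x : C) : Type :=
  if p is q.+1 then {y : C & (hom x y * string q y)%type} else unit.

Definition nerve (p : nat) : Type := {x : C & string p x}.

(* [string_face p i] deletes the vertex number i.+1 by composing the two
   adjacent arrows, or by dropping the last arrow if this vertex is the last. *)
Fixpoint string_face (p i : nat) (x : C) {struct p} :
    string p.+1 x -> string p x :=
  match p return string p.+1 x -> string p x with
  | 0 => fun _ => tt
  | q.+1 => fun s =>
    let: existT y (f, t) := s in
    if i is j.+1 then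
      existT (fun y => (hom x y * string q y)%type) y (f, string_face j t)
    else
      let: existT z (g, u) := t in
      existT (fun y => (hom x y * string q y)%type) z (g \oc f, u)
  end.

Definition nerve_face (p i : nat) (s : nerve p.+1) : nerve p :=
  let: existT x t := s in
  if i is j.+1 then existT (string p) x (string_face j t)
  else let: existT y (_, u) := t in existT (string p) y u.

Lemma string_faceK p i j x (t : string p.+2 x) : (i < j)%N ->
  string_face i (string_face j t) = string_face j.-1 (string_face i t).
Proof.
elim: p i j x t => [//|p IH] i j x; case: j => // j.
move=> [y [f [z [g [w [h t]]]]]] /=; rewrite ltnS.
case: i => [_|i]; first by case: j => [|j] //=; rewrite compA.
case: j => // j ij.
pose K s := existT (fun y => (hom x y * string p y)%type) y (f, s).
exact: (congr1 K (IH i j.+1 y (existT _ z (g, existT _ w (h, t))) ij)).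
Qed.

Lemma nerve_faceK p i j (s : nerve p.+2) : (i < j)%N ->
  nerve_face i (nerve_face j s) = nerve_face j.-1 (nerve_face i s).
Proof.
case: j => // j; case: i => [_|i ij].
  by case: s => x [y [f [z [g t]]]]; case: j.
case: s => x t; case: j ij => // j ij.
exact: (congr1 (existT (string p) x) (@string_faceK p i j.+1 x t ij)).
Qed.
End Nerve.

Lemma existT_inj (I : Type) (T : I -> Type) i (u v : T i) :
  existT T i u = existT T i v -> u = v.
Proof.
move=> e; have := projT2_eq e.
by have -> : projT1_eq e = erefl :> (i = i) by exact: Prop_irrelevance.
Qed.

Section NerveMap.
Variables (C D : category).
Implicit Types F G : cfunctor C D.

Fixpoint string_map F p x : string p x -> string p (F x) :=
  match p return string p x -> string p (F x) with
  | 0 => fun _ => tt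
  | q.+1 => fun s =>
    let: existT y (f, t) := s in
    existT (fun y' => (hom (F x) y' * string q y')%type) (F y)
      (cf_map F f, string_map F t)
  end.

Definition nerve_map F p (s : nerve C p) : nerve D p :=
  existT (string p) (F (tag s)) (string_map F (tagged s)).

Lemma string_map_face F p i x (t : string p.+1 x) :
  string_map F (string_face i t) = string_face i (string_map F t).
Proof.
elim: p i x t => [//|p IH] i x [y [f [z [g t]]]].
case: i => [|i]; first by rewrite /= cf_comp.
pose K s := existT (fun y' => (hom (F x) y' * string p y')%type) (F y)
  (cf_map F f, s).
exact: (congr1 K (IH i y (existT _ z (g, t)))).
Qed.

Lemma nerve_map_face F p i (s : nerve C p.+1) :
  nerve_map F (nerve_face i s) = nerve_face i (nerve_map F s).
Proof.
case: s => x t; case: i => [|i]; first by case: t => y [f t].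
by rewrite /nerve_map /= -string_map_face.
Qed.

Definition arrow (E : category) := {xy : E * E & hom xy.1 xy.2}.
Definition mk_arrow (E : category) (x y : E) (f : hom x y) : arrow E :=
  existT (fun xy : E * E => hom xy.1 xy.2) (x, y) f.

Lemma nerve_map_eq F G :
  (forall x y (f : hom x y), mk_arrow (cf_map F f) = mk_arrow (cf_map G f)) ->
  forall p, @nerve_map F p =1 @nerve_map G p.
Proof.
move=> FG p [x t]; elim: p x t => [|p IH] x t.
  by case: t; have /(congr1 (fun a : arrow D => (tag a).1)) /= := FG _ _ (idm x);
     rewrite /nerve_map /= => ->.
case: t => y [f t]; have := IH y t; have := FG x y f.
rewrite /nerve_map /=; move: (string_map F t) (string_map G t).
move: (cf_map F f) (cf_map G f); move: (F x) (F y) (G x) (G y).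
move=> x1 y1 x2 y2 f1 f2 t1 t2 e.
pose K (a : arrow D) := forall t1, existT (string p) (tag a).2 t1 =
  existT (string p) y2 t2 ->
  existT (string p.+1) (tag a).1 (existT (fun y' => (hom _ y' * string p y')%type)
    (tag a).2 (tagged a, t1)) =
  existT (string p.+1) x2 (existT (fun y' => (hom _ y' * string p y')%type)
    y2 (f2, t2)).
suff: K (mk_arrow f1) by apply.
by rewrite e /K /= => t3 e3; rewrite (existT_inj e3).
Qed.
End NerveMap.

Definition cfunctor_id (C : category) : cfunctor C C :=
  @CFunctor C C id (fun _ _ f => f) (fun _ => erefl) (fun _ _ _ _ _ => erefl).

Program Definition cfunctor_comp (C D E : category) (G : cfunctor D E)
    (F : cfunctor C D) : cfunctor C E :=
  @CFunctor C E (fun x => G (F x)) (fun _ _ f => cf_map G (cf_map F f)) _ _.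
Next Obligation. by move=> C D E G F x /=; rewrite !cf_id. Qed.
Next Obligation. by move=> C D E G F x y z g f /=; rewrite !cf_comp. Qed.

Lemma nerve_map_id (C : category) p (s : nerve C p) :
  nerve_map (cfunctor_id C) s = s.
Proof.
case: s => x t; congr (existT _ _ _) => /=.
by elim: p x t => [|p IH] x; [case | case=> y [f t] /=; rewrite IH].
Qed.

Lemma nerve_map_comp (C D E : category) (G : cfunctor D E) (F : cfunctor C D) p
    (s : nerve C p) :
  nerve_map (cfunctor_comp G F) s = nerve_map G (nerve_map F s).
Proof.
case: s => x t; congr (existT _ _ _) => /=.
by elim: p x t => [|p IH] x; [case | case=> y [f t] /=; rewrite IH].
Qed.

Section Under.
Variable C : category.

Definition under_ob (c : C) := {x : C & hom c x}.
Definition under_hom (c : C) (u v : under_ob c) :=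
  {a : hom (tag u) (tag v) | a \oc tagged u = tagged v}.

Lemma under_hom_eq c (u v : under_ob c) (a b : under_hom u v) :
  sval a = sval b -> a = b.
Proof. by case: a b => [a ea] [b eb] /= ab; apply: eq_exist. Qed.

Program Definition under (c : C) : category :=
  @Category (under_ob c) (@under_hom c)
    (fun u => exist _ (idm (tag u)) _)
    (fun u v w b a => exist _ (sval b \oc sval a) _) _ _ _.
Next Obligation. by move=> c u /=; rewrite comp_idl. Qed.
Next Obligation. by move=> c u v w [b eb] [a ea] /=; rewrite -compA ea. Qed.
Next Obligation. by move=> c u v f; apply: under_hom_eq; rewrite /= comp_idl. Qed.
Next Obligation. by move=> c u v f; apply: under_hom_eq; rewrite /= comp_idr. Qed.
Next Obligation. by move=> *; apply: under_hom_eq; rewrite /= compA. Qed.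

Program Definition under_map (c c' : C) (f : hom c c') :
    cfunctor (under c') (under c) :=
  @CFunctor (under c') (under c)
    (fun u => existT (fun x => hom c x) (tag u) (tagged u \oc f))
    (fun u v a => exist _ (sval a) _) _ _.
Next Obligation. by move=> c c' f u v [a ea] /=; rewrite compA ea. Qed.
Next Obligation. by move=> *; apply: under_hom_eq. Qed.
Next Obligation. by move=> *; apply: under_hom_eq. Qed.

Lemma under_arrow_eq c x y (a : hom x y) (u u' : hom c x) (v v' : hom c y)
    (e : a \oc u = v) (e' : a \oc u' = v') : u = u' -> v = v' ->
  mk_arrow (E := under c) (x := existT (hom c) x u) (y := existT (hom c) y v)
    (exist _ a e) =
  mk_arrow (E := under c) (x := existT (hom c) x u') (y := existT (hom c) y v')
    (exist _ a e').
Proof.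
move=> eu ev; case: _ / eu in e' *; case: _ / ev in e' *.
by rewrite (Prop_irrelevance e e').
Qed.

Lemma nerve_under_id c p (s : nerve (under c) p) :
  nerve_map (under_map (idm c)) s = s.
Proof.
rewrite -[RHS]nerve_map_id; apply: nerve_map_eq => -[x u] [y v] [a e] /=.
by apply: under_arrow_eq; rewrite /= comp_idr.
Qed.

Lemma nerve_under_comp c d e (g : hom d e) (f : hom c d) p
    (s : nerve (under e) p) :
  nerve_map (under_map (g \oc f)) s =
  nerve_map (under_map f) (nerve_map (under_map g) s).
Proof.
rewrite -nerve_map_comp; apply: nerve_map_eq => -[x u] [y v] [a ea] /=.
by apply: under_arrow_eq; rewrite /= compA.
Qed.
End Under.


Section LinearNerve.
Variable k : comPzRingType.

Definition free_map (X Y : Type) (f : X -> Y) : {linear freemod k X -> freemod k Y} :=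
  flift (fun x => fgen k (f x)).

Lemma free_map_gen (X Y : Type) (f : X -> Y) x :
  free_map f (fgen k x) = fgen k (f x).
Proof. exact: flift_gen. Qed.

Section NerveModule.
Variable C : category.

Definition nerve_module_map p (x y : opposite C) (f : hom x y) :=
  free_map (fun s : nerve (under (x : C)) p =>
              nerve_map (under_map (f : @hom C y x)) s).

Fact nerve_module_id p (x : opposite C) v : nerve_module_map p (idm x) v = v.
Proof.
apply: (@free_lin_ext _ _ _ _ idfun) => s.
by rewrite free_map_gen nerve_under_id.
Qed.

Fact nerve_module_comp p (x y z : opposite C) (g : hom y z) (f : hom x y) v :
  nerve_module_map p (g \oc f) v =
  nerve_module_map p g (nerve_module_map p f v).
Proof.
apply: (@free_lin_ext _ _ _ _ (nerve_module_map p g \o nerve_module_map p f)).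
move=> s; rewrite free_map_gen nerve_under_comp.
by rewrite -[RHS]/(free_map _ (free_map _ _)) !free_map_gen.
Qed.

(* k[N_p(- \ C)] *)
Definition nerve_module (p : nat) : contra_cmodule k C :=
  @CModule k (opposite C) (fun c : C => freemod k (nerve (under c) p))
    (@nerve_module_map p) (@nerve_module_id p) (@nerve_module_comp p).

Fact nerve_module_face_natural p i (x y : opposite C) (f : hom x y) v :
  free_map (nerve_face (p := p) i) (cm_map (nerve_module p.+1) f v) =
  cm_map (nerve_module p) f (free_map (nerve_face i) v).
Proof.
pose a (c : C) : {linear _ -> _} :=
  free_map (@nerve_face (@under C c) p i).
apply: (@free_lin_ext _ _ _ (a y \o nerve_module_map p.+1 f)
                            (nerve_module_map p f \o a x)) => s.
rewrite -[LHS]/(free_map _ (free_map _ _)) -[RHS]/(free_map _ (free_map _ _)).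
by rewrite !free_map_gen nerve_map_face.
Qed.

Definition nerve_module_face (p i : nat) :
    cmod_hom (nerve_module p.+1) (nerve_module p) :=
  @CModHom k (opposite C) (nerve_module p.+1) (nerve_module p)
    (fun c => free_map (@nerve_face (under (c : C)) p i))
    (@nerve_module_face_natural p i).

Variable N : cmodule k C.

Fact nerve_tensK p i j (u : tens (nerve_module p.+2) N) : (i < j <= p.+2)%N ->
  tens_map (nerve_module_face p i) N (tens_map (nerve_module_face p.+1 j) N u) =
  tens_map (nerve_module_face p j.-1) N
    (tens_map (nerve_module_face p.+1 i) N u).
Proof.
move=> /andP[ij _]; pose d p i := tens_map (nerve_module_face p i) N.
apply: (@tens_lin_ext _ _ _ _ _ (d p i \o d p.+1 j) (d p j.-1 \o d p.+1 i)).
move=> c y n; rewrite -[LHS]/(tens_map _ _ (tens_map _ _ _)).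
rewrite -[RHS]/(tens_map _ _ (tens_map _ _ _)) !tens_mapE.
congr (tensor _ _).
pose a p i : {linear _ -> _} := free_map (@nerve_face (@under C c) p i).
suff H : (a p i \o a p.+1 j) =1 (a p j.-1 \o a p.+1 i) by exact: (H y).
apply: free_lin_ext => s.
rewrite -[LHS]/(free_map _ (free_map _ _)) -[RHS]/(free_map _ (free_map _ _)).
by rewrite !free_map_gen nerve_faceK.
Qed.

(* k[N(- \ C)] (x)_C N *)
Definition nerve_tens : simp_module k :=
  @SimpModule k (fun p => tens (nerve_module p) N)
    (fun p i => tens_map (nerve_module_face p i) N)
    (fun p i j u ij => nerve_tensK u ij).
End NerveModule.

Program Definition const_module (C : category) : cmodule k C :=
  @CModule k C (fun _ => k^o) (fun _ _ _ => idfun) _ _.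
Next Obligation. by []. Qed.
Next Obligation. by []. Qed.
End LinearNerve.

Section DeltaS.

(* A morphism [n] -> [m]: a map together with a strict total order on each of its
   fibres; elements of distinct fibres are unrelated. *)
Record dS_hom (n m : nat) := DSHom {
  dS_fun :> 'I_n.+1 -> 'I_m.+1;
  dS_lt : rel 'I_n.+1;
  dS_lt_fib : forall i j, dS_lt i j -> dS_fun i = dS_fun j;
  dS_lt_irr : irreflexive dS_lt;
  dS_lt_trans : transitive dS_lt;
  dS_lt_total : forall i j, dS_fun i = dS_fun j -> i != j ->
    dS_lt i j || dS_lt j i }.

Lemma dS_hom_eq n m (a b : dS_hom n m) :
  dS_fun a = dS_fun b -> dS_lt a = dS_lt b -> a = b.
Proof.
case: a b => [f r p1 p2 p3 p4] [g s q1 q2 q3 q4] /= e1 e2.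
by subst; f_equal; exact: Prop_irrelevance.
Qed.

Program Definition dS_id n : dS_hom n n := @DSHom n n id (fun _ _ => false) _ _ _ _.
Next Obligation. by []. Qed.
Next Obligation. by []. Qed.
Next Obligation. by []. Qed.
Next Obligation. by move=> n i j ->; rewrite eqxx. Qed.

Program Definition dS_comp n m p (b : dS_hom m p) (a : dS_hom n m) : dS_hom n p :=
  @DSHom n p (fun i => b (a i))
    (fun i j => dS_lt b (a i) (a j) || (a i == a j) && dS_lt a i j) _ _ _ _.
Next Obligation.
by move=> n m p b a i j /= /orP[/dS_lt_fib //|/andP[/eqP->]].
Qed.
Next Obligation. by move=> n m p b a i /=; rewrite !dS_lt_irr andbF. Qed.
Next Obligation.
move=> n m p b a j i l /= /orP[ij|/andP[/eqP ij rij]] /orP[jl|/andP[/eqP jl rjl]].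
- by rewrite (dS_lt_trans ij jl).
- by rewrite -jl ij.
- by rewrite ij jl.
- by rewrite ij jl eqxx (dS_lt_trans rij rjl) orbT.
Qed.
Next Obligation.
move=> n m p b a i j /= bij ij; have [aij|aij] := eqVneq (a i) (a j).
  by case/orP: (dS_lt_total aij ij) => ->; rewrite /= ?orbT.
by case/orP: (dS_lt_total bij aij) => ->; rewrite ?orbT.
Qed.

(* The object n stands for [n] = {0, ..., n}. *)
Program Definition DeltaS : category :=
  @Category nat dS_hom dS_id dS_comp _ _ _.
Next Obligation.
move=> n m a; apply: dS_hom_eq => //=; apply/funext=> i; apply/funext=> j /=.
by apply/andb_idl => /dS_lt_fib ->.
Qed.
Next Obligation.
move=> n m a; apply: dS_hom_eq => //=; apply/funext=> i; apply/funext=> j /=.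
by rewrite andbF orbF.
Qed.
Next Obligation.
move=> n m p q c b a; apply: dS_hom_eq => //=.
apply/funext=> i; apply/funext=> j /=.
rewrite -orbA; congr (_ || _); case: (eqVneq (a i) (a j)) => [->|_] /=.
  by rewrite eqxx dS_lt_irr.
by rewrite !orbF.
Qed.

End DeltaS.

(* C with a new initial object None that receives no morphism from C *)
Section AdjoinInitial.
Variable C : category.

Definition init_hom (x y : option C) : Type :=
  match x, y with
  | None, _ => unit
  | Some _, None => Empty_set
  | Some a, Some b => hom a b
  end.

Definition init_id (x : option C) : init_hom x x :=
  if x is Some a then idm a else tt.

Definition init_comp (x y z : option C) :
    init_hom y z -> init_hom x y -> init_hom x z :=
  match x, y, z with
  | None, _, _ => fun _ _ => tt
  | Some _, None, _ => fun _ f => match f with end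
  | Some _, Some _, None => fun g _ => g
  | Some _, Some _, Some _ => fun g f => g \oc f
  end.

Program Definition adjoin_initial : category :=
  @Category (option C) init_hom init_id init_comp _ _ _.
Next Obligation.
by move=> [x|] [y|] /= f; [exact: comp_idl | case: f..].
Qed.
Next Obligation.
by move=> [x|] [y|] /= f; [exact: comp_idr | case: f..].
Qed.
Next Obligation.
by move=> [x|] [y|] [z|] [t|] //= h g f; exact: compA.
Qed.
End AdjoinInitial.

Definition DeltaSplus : category := adjoin_initial DeltaS.

Section Fibre.
Variables (n m : nat) (a : dS_hom n m).

(* the fibre over j, listed in increasing order *)
Definition dS_fibre (j : 'I_m.+1) : seq 'I_n.+1 :=
  sort (fun i i' => (i == i') || dS_lt a i i') [seq i <- enum 'I_n.+1 | a i == j].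

Lemma mem_dS_fibre j i : (i \in dS_fibre j) = (a i == j).
Proof. by rewrite mem_sort mem_filter mem_enum andbT. Qed.

Lemma dS_fibre_uniq j : uniq (dS_fibre j).
Proof. by rewrite sort_uniq filter_uniq // enum_uniq. Qed.

Lemma dS_fibre_pairwise j : pairwise (dS_lt a) (dS_fibre j).
Proof.
pose le i i' := (i == i') || dS_lt a i i'.
have le_tr : transitive le.
  move=> y x z /orP[/eqP-> //|xy] /orP[/eqP<-|yz]; rewrite /le ?xy ?orbT //.
  by rewrite (dS_lt_trans xy yz) orbT.
have : pairwise le (dS_fibre j).
  rewrite -(sorted_pairwise le_tr).
  apply: (@sort_sorted_in _ [pred i | a i == j]); last exact: filter_all.
  move=> x y; rewrite !inE => /eqP ax /eqP ay; rewrite /le eq_sym.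
  have [//|xy] := eqVneq y x.
  by apply: dS_lt_total; [rewrite ax ay | rewrite eq_sym].
have := dS_fibre_uniq j; rewrite uniq_pairwise => neq le_s.
have : pairwise [rel x y | (x != y) && le x y] (dS_fibre j).
  by rewrite pairwise_relI neq le_s.
by apply: sub_pairwise => x y /=; rewrite /le; case: eqVneq.
Qed.
End Fibre.

Lemma dS_fibre_id n (j : 'I_n.+1) : dS_fibre (dS_id n) j = [:: j].
Proof.
rewrite /dS_fibre /= (_ : [seq _ <- _ | _] = [:: j]) //.
by apply: (filter_pred1_uniq (enum_uniq _)); rewrite mem_enum.
Qed.

Lemma dS_fibre_comp n m p (b : dS_hom m p) (a : dS_hom n m) l :
  dS_fibre (dS_comp b a) l = flatten [seq dS_fibre a j | j <- dS_fibre b l].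
Proof.
pose lt := dS_lt (dS_comp b a).
have lt_tr : transitive lt by exact: dS_lt_trans.
apply: (irr_sorted_eq lt_tr (@dS_lt_irr _ _ (dS_comp b a))).
- by rewrite (sorted_pairwise lt_tr) dS_fibre_pairwise.
- rewrite (sorted_pairwise lt_tr); have := dS_fibre_pairwise b l.
  elim: (dS_fibre b l) => //= j s IH /andP[js /IH ps].
  rewrite pairwise_cat ps andbT; apply/andP; split; last first.
    apply: sub_pairwise (dS_fibre_pairwise a j) => x y xy.
    by rewrite /lt /= xy (dS_lt_fib xy) eqxx orbT.
  apply/allrelP => x y; rewrite mem_dS_fibre => /eqP xj /flatten_mapP[j' j's].
  rewrite mem_dS_fibre => /eqP yj'; subst j j'.
  by rewrite /lt /= (allP js).
- move=> i; rewrite mem_dS_fibre; apply/eqP/flatten_mapP => /= [bai|].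
    by exists (a i); rewrite mem_dS_fibre ?bai.
  by case=> j; rewrite !mem_dS_fibre => /eqP bj /eqP ->.
Qed.

Section SymFunctor.
Variables (k : comPzRingType) (A : kalgebra k).

Section TensorPower.
Variable n : nat.

(* a with its i-th entry replaced by u *)
Definition upd (a : 'I_n.+1 -> A) (i : 'I_n.+1) (u : A) : 'I_n.+1 -> A :=
  fun j => if j == i then u else a j.

Inductive tpow_rel : set (freemod k ('I_n.+1 -> A)) :=
| TpowD a i (u v : A) :
    tpow_rel (fgen k (upd a i (u + v)) - fgen k (upd a i u) - fgen k (upd a i v))
| TpowZ a i (c : k) (u : A) :
    tpow_rel (fgen k (upd a i (kalg_unit A c * u)) - c *: fgen k (upd a i u)).

(* the (n+1)-fold tensor power of A over k *)
Definition tpow : lmodType k := quotmod tpow_rel.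

Definition tpure (a : 'I_n.+1 -> A) : tpow := qpi _ (fgen k a).

Lemma tpow_lin_ext (W : lmodType k) (f g : {linear tpow -> W}) :
  (forall a, f (tpure a) = g (tpure a)) -> f =1 g.
Proof.
move=> fg u; rewrite -(qreprK u); set v := qrepr u.
apply: (@free_lin_ext _ _ _ (f \o qpi _) (g \o qpi _)).
exact: fg.
Qed.
End TensorPower.

Section Push.
Variables (n m : nat) (al : dS_hom n m).

Definition push (a : 'I_n.+1 -> A) : 'I_m.+1 -> A :=
  fun j => \prod_(i <- dS_fibre al j) a i.

Lemma push_upd a i : exists P Q : A, forall u,
  push (upd a i u) = upd (push a) (al i) (P * u * Q).
Proof.
have [s [t E]] : exists s t, dS_fibre al (al i) = s ++ i :: t.
  have : i \in dS_fibre al (al i) by rewrite mem_dS_fibre.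
  by case/splitPr => s t; exists s, t.
have us := dS_fibre_uniq al (al i); rewrite E in us.
exists (\prod_(j <- s) a j), (\prod_(j <- t) a j) => u.
apply/funext => j; rewrite /push {2}/upd.
case: eqVneq => [->|ji].
  rewrite E big_cat big_cons /= {2}/upd eqxx mulrA.
  move: us; rewrite cat_uniq /= negb_or => /and3P[_ /andP[is_ _] /andP[it _]].
  congr (_ * _ * _); apply: eq_big_seq => x xs; rewrite /upd;
    by case: eqVneq => // xi; subst x; rewrite xs in is_ it.
apply: eq_big_seq => x; rewrite mem_dS_fibre /upd => /eqP xj.
by case: eqVneq => // xi; rewrite -xj xi eqxx in ji.
Qed.

Fact sym_map_subproof v : tpow_rel v -> flift (fun a => tpure (push a)) v = 0.
Proof.
pose q : {linear _ -> _} := qpi (@tpow_rel m).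
pose L : {linear _ -> tpow m} := flift (fun a => tpure (push a)).
have E a : L (fgen k a) = q (fgen k (push a)) by exact: flift_gen.
have rel0 u : tpow_rel u -> q u = 0.
  move=> /mem_submod_span ru; rewrite -(raddf0 q); apply/eqP.
  by rewrite [_ == _]qpi_eq subr0.
rewrite -[flift _ v]/(L v).
case=> {v} a i; have [P [Q PQ]] := push_upd a i.
- move=> u v; rewrite 2!(linearB L) !E -2!(linearB q) !PQ; apply: rel0.
  by rewrite mulrDr mulrDl; apply: TpowD.
- move=> c u; rewrite (linearB L) (linearZ_LR L) !E -(linearZ_LR q) -(linearB q).
  rewrite !PQ; apply: rel0.
  by rewrite mulrA -kalg_unitC -!mulrA; apply: TpowZ.
Qed.

Definition sym_map : {linear tpow n -> tpow m} := qlift_lin sym_map_subproof.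

Lemma sym_map_tpure a : sym_map (tpure a) = tpure (push a).
Proof.
rewrite -[LHS]/(qlift (flift (fun a => tpure (push a))) (qpi _ (fgen k a))).
by rewrite (qliftE (@sym_map_subproof)) /= flift_gen.
Qed.
End Push.

Fact sym_map_id n (v : tpow n) : sym_map (dS_id n) v = v.
Proof.
apply: (@tpow_lin_ext _ _ _ idfun) => a; rewrite sym_map_tpure /=; congr tpure.
by apply/funext => j; rewrite /push dS_fibre_id big_seq1.
Qed.

Fact sym_map_comp n m p (b : dS_hom m p) (a : dS_hom n m) (v : tpow n) :
  sym_map (dS_comp b a) v = sym_map b (sym_map a v).
Proof.
apply: (@tpow_lin_ext _ _ _ (sym_map b \o sym_map a)) => x.
rewrite -[RHS]/(sym_map b (sym_map a (tpure x))) !sym_map_tpure; congr tpure.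
apply/funext => j; rewrite /push dS_fibre_comp big_flatten big_map.
by [].
Qed.

Definition Bsym : cmodule k DeltaS :=
  @CModule k DeltaS tpow (@sym_map) sym_map_id sym_map_comp.

Definition Bsymplus_ob (x : DeltaSplus) : lmodType k :=
  if x is Some n then tpow n else k^o.

Fact sym_unit_linear n : linear (fun c : k^o => (c : k) *: tpure (fun _ : 'I_n.+1 => 1)).
Proof. by move=> c x y; rewrite scalerDl scalerA. Qed.
Definition sym_unit n : {linear k^o -> tpow n} :=
  HB.pack (fun c : k^o => (c : k) *: tpure (fun _ : 'I_n.+1 => 1))
    (GRing.isLinear.Build k k^o (tpow n) *:%R _ (@sym_unit_linear n)).

Definition Bsymplus_map (x y : DeltaSplus) :
    hom x y -> {linear Bsymplus_ob x -> Bsymplus_ob y} :=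
  match x, y return @hom DeltaSplus x y -> {linear Bsymplus_ob x -> Bsymplus_ob y} with
  | None, None => fun _ => idfun
  | None, Some n => fun _ => sym_unit n
  | Some _, None => fun f => match f with end
  | Some _, Some _ => fun f => sym_map f
  end.

Fact Bsymplus_id (x : DeltaSplus) (v : Bsymplus_ob x) :
  Bsymplus_map (idm x) v = v.
Proof. by case: x v => [n|] v //; apply: sym_map_id. Qed.

Fact Bsymplus_comp (x y z : DeltaSplus) (g : hom y z) (f : hom x y)
    (v : Bsymplus_ob x) :
  Bsymplus_map (g \oc f) v = Bsymplus_map g (Bsymplus_map f v).
Proof.
case: x y z g f v => [n|] [m|] [p|] //= g f v; first exact: sym_map_comp.
rewrite -[RHS]/(sym_map g ((v : k) *: tpure (fun=> 1))) (linearZ_LR (sym_map g)).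
by rewrite sym_map_tpure; congr (_ *: tpure _); apply/funext => j; rewrite /push big1.
Qed.

Definition Bsymplus : cmodule k DeltaSplus :=
  @CModule k DeltaSplus Bsymplus_ob Bsymplus_map Bsymplus_id Bsymplus_comp.

(* [T] is the [n]-th symmetric homology module of [A], up to isomorphism. *)
Definition is_HS (n : nat) (T : lmodType k) : Prop :=
  is_Tor (const_module k (opposite DeltaS)) Bsym n T.

Definition Yplus : simp_module k := nerve_tens Bsymplus.
End SymFunctor.

(* Main.v *)
From HB Require Import structures.
From mathcomp Require Import all_boot all_order all_algebra.
From mathcomp Require Import boolp.
Require Import Defs.

(** Symmetric homology is [Tor] over [DeltaS] of the constant functor with [Bsym A],
    while the complex of [Yplus A] computes [Tor] over [DeltaSplus] of the constant
    functor with [Bsymplus A]: the modules k[N_p(- \ C)] form a projective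
    resolution of the constant functor.  So the assertion is that adjoining the
    initial object [-1] does not change this [Tor], and the reason is that the
    inclusion j : DeltaS -> DeltaSplus is homotopy cofinal: every comma category
    d | j is contractible.

    For a functor j : C -> D, let E^j_p(d) be the free module on the diagrams
    d -> j x_0, x_0 -> ... -> x_p with the x_i in C ([bar_module]).  These modules
    form an augmented complex of contravariant functors on D ([bar_cx]), whose
    value at d is the chain complex of the nerve of d | j.  Four facts carry the
    proof.

    - E^j_p is free with basis elements living at the objects j x, so maps out of it
      lift through any map that is onto the relevant image at these objects alone
      ([bar_lifts]).
    - E^j (x)_D N and E^id (x)_C j^*N are isomorphic complexes: both are, in degree
      p, the sum over the strings x_0 -> ... -> x_p of C of the modules N(j x_0)
      ([change_of_category]).
    - When j is the identity, E^j is the nerve complex k[N(- \ D)]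
      ([nerve_tens_bar]).
    - If E^j is exact at every object, then E^j and E^id are two projective
      resolutions of the constant functor on D, hence give the same homology after
      tensoring ([tens_comparison]).

    The comparison over C identifies the homology of E^id (x)_C j^*N with [Tor],
    whatever the projective resolution that computes it. The theorem is thus
    reduced to the exactness of E^j for the inclusion j of DeltaS into DeltaSplus.
    At an object [n] of DeltaS the category [n] | j has an initial object, and
    coning off with it is a contraction. At [-1], where E^j is the chain complex
    of the nerve of DeltaS, one uses the functor G = [0] * - of disjoint union
    with a point on the left, and the natural inclusions x -> G x <- [0]: the
    endomorphism of E^j induced by x -> G x is chain homotopic to the identity,
    and the cone with apex [0] shows that it annihilates the homology of the
    augmented complex. The first homotopy needs no explicit prism operators: both
    endomorphisms lift the identity of the constant functor, E^j is free on
    elements living at objects of DeltaS, and E^j is already known to be exact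
    there, so the comparison theorem provides a homotopy defined at all objects,
    including [-1]. *)

Set Implicit Arguments.
Unset Strict Implicit.
Unset Printing Implicit Defensive.

Import GRing.Theory.
Local Open Scope ring_scope.
Local Obligation Tactic := idtac.

(** * Maps induced in homology *)

Section LinearIso.
Variable k : pzRingType.

Lemma linear_inverse (U V : lmodType k) (f : {linear U -> V}) :
  bijective f -> exists g : {linear V -> U}, cancel f g /\ cancel g f.
Proof.
case=> g fK gK.
have g_lin : linear g.
  by move=> a x y; apply: (can_inj fK); rewrite linearP !gK.
pose h : {linear V -> U} := HB.pack g (GRing.isLinear.Build k V U *:%R g g_lin).
by exists h.
Qed.

Lemma lmod_iso_sym (U V : lmodType k) : lmod_iso U V -> lmod_iso V U.
Proof. by case=> f /linear_inverse[g [fK gK]]; exists g, f. Qed.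

Lemma lmod_iso_trans (U V W : lmodType k) :
  lmod_iso U V -> lmod_iso V W -> lmod_iso U W.
Proof. by case=> f bf [g bg]; exists (g \o f); apply: bij_comp. Qed.
End LinearIso.

Section HomologyMap.
Variable k : comPzRingType.

Section Induced.
Variables (X Y : chain_complex k) (n : nat) (f : {linear X n -> Y n}).
Hypothesis f_cycle : forall x, x \in @cyclep k X n -> f x \in @cyclep k Y n.
Hypothesis f_bound : forall x, exists y, cc_diff Y n y = f (cc_diff X n x).

Lemma cycle_valP (z : cycles X n) : cycle_val z \in @cyclep k X n.
Proof. by case: z. Qed.

Definition cycles_map (z : cycles X n) : cycles Y n :=
  Cycle (f_cycle (cycle_valP z)).

Fact cycles_map_linear : linear cycles_map.
Proof. by move=> a x y; apply: val_inj; rewrite /= linearP. Qed.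
HB.instance Definition _ :=
  GRing.isLinear.Build k (cycles X n) (cycles Y n) *:%R cycles_map cycles_map_linear.

Definition cycles_class : {linear cycles X n -> homology Y n} :=
  qpi _ \o cycles_map.

Fact cycles_class0 z :
  (exists y, cc_diff X n y = cycle_val z) -> cycles_class z = 0.
Proof.
case=> x xz; rewrite -(raddf0 (qpi _)); apply/eqP; rewrite qpi_eq subr0.
by apply: mem_submod_span; have [y yx] := f_bound x; exists y; rewrite yx xz.
Qed.

Definition homology_map : {linear homology X n -> homology Y n} :=
  qlift_lin cycles_class0.

Lemma homology_mapE z : homology_map (qpi _ z) = qpi _ (cycles_map z).
Proof. exact: (qliftE cycles_class0). Qed.
End Induced.

Lemma homology_map_cancel (X Y : chain_complex k) n
    (f : {linear X n -> Y n}) (g : {linear Y n -> X n}) fc fb gc gb :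
  (forall x, x \in @cyclep k X n -> exists y, cc_diff X n y = g (f x) - x) ->
  cancel (@homology_map X Y n f fc fb) (@homology_map Y X n g gc gb).
Proof.
move=> gf u; rewrite -(qreprK u) !homology_mapE.
apply/eqP; rewrite qpi_eq; apply: mem_submod_span.
exact: gf (cycle_valP _).
Qed.

(** Chain maps that are mutually inverse up to boundaries on the cycles induce
    inverse maps in homology.  A chain homotopy h gives such boundaries: on a cycle
    its term h d vanishes, and d h is left. *)
Lemma homology_iso (X Y : chain_complex k)
    (f : forall n, {linear X n -> Y n}) (g : forall n, {linear Y n -> X n}) :
  (forall n x, f n (cc_diff X n x) = cc_diff Y n (f n.+1 x)) ->
  (forall n y, g n (cc_diff Y n y) = cc_diff X n (g n.+1 y)) ->
  (forall n x, x \in @cyclep k X n ->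
     exists x', cc_diff X n x' = g n (f n x) - x) ->
  (forall n y, y \in @cyclep k Y n ->
     exists y', cc_diff Y n y' = f n (g n y) - y) ->
  forall n, lmod_iso (homology X n) (homology Y n).
Proof.
move=> fd gd gf fg n.
have cyc (X' Y' : chain_complex k) (h : forall n, {linear X' n -> Y' n}) :
    (forall n x, h n (cc_diff X' n x) = cc_diff Y' n (h n.+1 x)) ->
    forall x, x \in @cyclep k X' n -> h n x \in @cyclep k Y' n.
  move=> hd; case: n => // n x; rewrite !unfold_in /= => /eqP dx.
  by rewrite -hd dx raddf0.
have fb x : exists y, cc_diff Y n y = f n (cc_diff X n x) by exists (f n.+1 x).
have gb x : exists y, cc_diff X n y = g n (cc_diff Y n x) by exists (g n.+1 x).
exists (homology_map (cyc _ _ _ fd) fb).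
exists (homology_map (cyc _ _ _ gd) gb); apply: homology_map_cancel; auto.
Qed.

Lemma homology_iso_bij (X Y : chain_complex k)
    (f : forall n, {linear X n -> Y n}) :
  (forall n, bijective (f n)) ->
  (forall n x, f n (cc_diff X n x) = cc_diff Y n (f n.+1 x)) ->
  forall n, lmod_iso (homology X n) (homology Y n).
Proof.
move=> f_bij fd.
have inv n := linear_inverse (f_bij n).
pose g n := sval (cid (inv n)).
have fK n : cancel (f n) (g n) by case: (svalP (cid (inv n))).
have gK n : cancel (g n) (f n) by case: (svalP (cid (inv n))).
apply: (@homology_iso X Y f g) => // n x.
- by apply: (can_inj (fK n)); rewrite fd !gK.
- by exists 0; rewrite fK subrr raddf0.
- by exists 0; rewrite gK subrr raddf0.
Qed.

Lemma chain_complex_eq (X : nat -> lmodType k)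
    (d : forall n, {linear X n.+1 -> X n}) p q :
  @ChainComplex k X d p = @ChainComplex k X d q.
Proof. by rewrite (Prop_irrelevance p q). Qed.
End HomologyMap.

(** * The comparison theorem *)

(** Dependent choice, with an invariant [G] that keeps a next term available. *)
Lemma dependent_sequence (T : nat -> Type) (G : forall n, T n -> Prop)
    (R : forall n, T n -> T n.+1 -> Prop) (t0 : T 0) :
  G 0 t0 -> (forall n t, G n t -> exists t', G n.+1 t' /\ R n t t') ->
  exists s : forall n, T n, s 0 = t0 /\ forall n, R n (s n) (s n.+1).
Proof.
move=> G0 next.
have step n (t : {t : T n | G n t}) :
    {t' : {t : T n.+1 | G n.+1 t} | R n (sval t) (sval t')}.
  apply: cid; case: t => t Gt; have [t' [Gt' Rt]] := next n t Gt.
  by exists (exist _ t' Gt').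
pose F := nat_rect (fun n => {t : T n | G n t}) (exist _ t0 G0)
  (fun n t => sval (step n t)).
by exists (fun n => sval (F n)); split=> // n; apply: (svalP (step n (F n))).
Qed.

Section Comparison.
Variables (k : comPzRingType) (C : category).
Implicit Types M N P : cmodule k C.

Definition cmod_id M : cmod_hom M M :=
  @CModHom k C M M (fun x => idfun) (fun _ _ _ _ => erefl).

Program Definition cmod_comp M N P (g : cmod_hom N P) (f : cmod_hom M N) :
    cmod_hom M P :=
  @CModHom k C M P (fun x => g x \o f x) _.
Next Obligation. by move=> M N P g f x y a v /=; rewrite !nt_natural. Qed.

Program Definition cmod_sub M N (f g : cmod_hom M N) : cmod_hom M N :=
  @CModHom k C M N (fun x => f x \- g x) _.
Next Obligation. by move=> M N f g x y a v /=; rewrite !nt_natural raddfB. Qed.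

Program Definition cmod_zero M N : cmod_hom M N :=
  @CModHom k C M N (fun x => \0) _.
Next Obligation. by move=> M N x y a v /=; rewrite raddf0. Qed.

(** An augmented resolution of M is treated as one complex with M in degree 0, the
    degrees of the resolution being shifted by 1.  The augmentation is then one of
    the differentials, and lifting the identity of M is an ordinary induction. *)
Record cmod_complex := CModComplex {
  cx_ob :> nat -> cmodule k C;
  cx_diff : forall n, cmod_hom (cx_ob n.+1) (cx_ob n);
  cx_diffK : forall n x v, cx_diff n x (cx_diff n.+1 x v) = 0 }.

Definition exact_at (Z : cmod_complex) (x : C) : Prop :=
  (forall v, exists u, cx_diff Z 0 x u = v) /\
  forall n v, cx_diff Z n x v = 0 -> exists u, cx_diff Z n.+1 x u = v.

(** The lifting property of projectives, where surjectivity onto the relevant image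
    is required at the objects [J i] only.  A functor that is free on elements
    living at these objects has it, and it makes the comparison theorem applicable
    to complexes that are known to be exact at these objects only. *)
Definition lifts (I : Type) (J : I -> C) P : Prop :=
  forall M N (e : cmod_hom M N) (f : cmod_hom P N),
    (forall i v, exists u, e (J i) u = f (J i) v) ->
  exists g : cmod_hom P M, forall x v, e x (g x v) = f x v.

(** The objectwise image of a morphism, needed because [projective] speaks of
    epimorphisms: a map into the image of [e] is lifted along the corestriction of
    [e]. *)
Section Image.
Variables (M N : cmodule k C) (e : cmod_hom M N).

Definition in_image (x : C) : {pred N x} := fun v => `[< exists u, e x u = v >].

Fact in_image_closed x : submod_closed (@in_image x).
Proof.
split=> [|a _ _ /asboolP[u <-] /asboolP[v <-]]; apply/asboolP.
  by exists 0; rewrite raddf0.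
by exists (a *: u + v); rewrite linearP.
Qed.
HB.instance Definition _ x :=
  GRing.isSubmodClosed.Build k (N x) (@in_image x) (@in_image_closed x).

Record image x := Image { image_val :> N x; _ : image_val \in @in_image x }.
HB.instance Definition _ x := [isSub for @image_val x].
HB.instance Definition _ x := [Choice of image x by <:].
HB.instance Definition _ x := [SubChoice_isSubLmodule of image x by <:].

Lemma imageP x (w : image x) : exists u, e x u = image_val w.
Proof. by case: w => v vi; apply/asboolP. Qed.

Fact image_map_subproof x y (f : hom x y) (w : image x) :
  cm_map N f (image_val w) \in @in_image y.
Proof.
have [u uw] := imageP w; apply/asboolP; exists (cm_map M f u).
by rewrite nt_natural uw.
Qed.
Definition image_map x y (f : hom x y) (w : image x) : image y :=
  Image (image_map_subproof f w).

Fact image_map_linear x y (f : hom x y) : linear (image_map f).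
Proof. by move=> a u v; apply: val_inj; rewrite /= linearP. Qed.
HB.instance Definition _ x y (f : hom x y) :=
  GRing.isLinear.Build k (image x) (image y) *:%R (image_map f) (image_map_linear f).

Program Definition image_module : cmodule k C :=
  @CModule k C (fun x => image x) (fun x y f => image_map f) _ _.
Next Obligation. by move=> x v; apply: val_inj; rewrite /= cm_id. Qed.
Next Obligation. by move=> x y z g f v; apply: val_inj; rewrite /= cm_comp. Qed.

Section Corestriction.
Variables (P : cmodule k C) (f : cmod_hom P N).
Hypothesis fe : forall x v, f x v \in @in_image x.

Definition corestr x (v : P x) : image x := Image (fe v).
Fact corestr_linear x : linear (@corestr x).
Proof. by move=> a u v; apply: val_inj; rewrite /= linearP. Qed.
HB.instance Definition _ x :=
  GRing.isLinear.Build k (P x) (image x) *:%R (@corestr x) (@corestr_linear x).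

Program Definition corestr_hom : cmod_hom P image_module :=
  @CModHom k C P image_module (fun x => @corestr x) _.
Next Obligation. by move=> x y a v; apply: val_inj; rewrite /= nt_natural. Qed.
End Corestriction.
End Image.

Lemma projective_lifts P : projective P -> lifts id P.
Proof.
move=> projP M N e f fe.
have fi x v : f x v \in @in_image _ _ e x by apply/asboolP; apply: fe.
have ei x v : e x v \in @in_image _ _ e x by apply/asboolP; exists v.
have [|g gP] := projP _ _ (corestr_hom ei) (corestr_hom fi).
  by move=> x w; have [u uw] := imageP w; exists u; apply: val_inj.
by exists g => x v; have /(congr1 (@image_val _ _ _ _)) := gP x v.
Qed.

Lemma lifts_projective P : lifts id P -> projective P.
Proof. by move=> lP M N e f epi; apply: lP => x v; apply: epi. Qed.

Definition is_chain_map (Z Z' : cmod_complex)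
    (f : forall n, cmod_hom (Z n) (Z' n)) : Prop :=
  forall n x v, cx_diff Z' n x (f n.+1 x v) = f n x (cx_diff Z n x v).

Section Lifting.
Variables (Z Z' : cmod_complex) (I : Type) (J : I -> C).
Hypothesis liftZ : forall n, lifts J (Z n.+1).
Hypothesis exactZ' : forall i, exact_at Z' (J i).

(** The invariant of the induction is that [f n \o d] takes its values, at the
    objects [J i], in the image of the differential of [Z']. *)
Lemma chain_lift (f0 : cmod_hom (Z 0) (Z' 0)) :
  exists f : forall n, cmod_hom (Z n) (Z' n), f 0 = f0 /\ is_chain_map f.
Proof.
apply: (dependent_sequence (T := fun n => cmod_hom (Z n) (Z' n))
  (G := fun n f => forall i v,
     exists u, cx_diff Z' n (J i) u = f (J i) (cx_diff Z n (J i) v))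
  (R := fun n f f' => forall x v,
     cx_diff Z' n x (f' x v) = f x (cx_diff Z n x v))) => [i v|n f fP].
  by have [epi _] := exactZ' i; apply: epi.
have [g gP] := liftZ (e := cx_diff Z' n) (f := cmod_comp f (cx_diff Z n)) fP.
exists g; split=> // i v; have [_ ex] := exactZ' i; apply: ex.
by rewrite gP /= cx_diffK raddf0.
Qed.

(** As for [chain_lift], the map to be lifted in degree n + 1, here f - h d, has to be
    kept inside the image of the differential. *)
Lemma chain_homotopy (f : forall n, cmod_hom (Z n) (Z' n)) :
  is_chain_map f -> (forall x v, f 0 x v = 0) ->
  exists h : forall n, cmod_hom (Z n) (Z' n.+1),
    h 0 = cmod_zero _ _ /\ forall n x v,
    cx_diff Z' n.+1 x (h n.+1 x v) = f n.+1 x v - h n x (cx_diff Z n x v).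
Proof.
move=> fd f0.
apply: (dependent_sequence (T := fun n => cmod_hom (Z n) (Z' n.+1))
  (G := fun n h => forall i v, exists u, cx_diff Z' n.+1 (J i) u =
     f n.+1 (J i) v - h (J i) (cx_diff Z n (J i) v))
  (R := fun n h h' => forall x v,
     cx_diff Z' n.+1 x (h' x v) = f n.+1 x v - h x (cx_diff Z n x v)))
  => [i v|n h hP].
  have [_ ex] := exactZ' i; rewrite subr0; apply: ex.
  by rewrite fd f0.
have [g gP] := liftZ (e := cx_diff Z' n.+1)
  (f := cmod_sub (f n.+1) (cmod_comp h (cx_diff Z n))) hP.
exists g; split=> // i v; have [_ ex] := exactZ' i; apply: ex.
by rewrite raddfB /= fd gP /= cx_diffK raddf0 subr0 subrr.
Qed.
End Lifting.
End Comparison.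

(** * Tensor products over a category *)

Section TensorCalculus.
Variables (k : comPzRingType) (C : category).
Implicit Types (M : contra_cmodule k C) (N : cmodule k C).

Lemma qpi_rel0 (V : lmodType k) (S : classical_sets.set V) v : S v -> qpi S v = 0.
Proof.
move=> Sv; rewrite -(raddf0 (qpi S)); apply/eqP; rewrite qpi_eq subr0.
exact: mem_submod_span.
Qed.

Lemma tensorDl M N (x : C) (y y' : M x) (n : N x) :
  tensor (y + y') n = tensor y n + tensor y' n.
Proof.
apply/eqP; rewrite -subr_eq0 opprD addrA -!raddfB; apply/eqP.
exact: qpi_rel0 (TensDl _ _ _).
Qed.

Lemma tensorDr M N (x : C) (y : M x) (n n' : N x) :
  tensor y (n + n') = tensor y n + tensor y n'.
Proof.
apply/eqP; rewrite -subr_eq0 opprD addrA -!raddfB; apply/eqP.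
exact: qpi_rel0 (TensDr _ _ _).
Qed.

Lemma tensorZl M N (x : C) a (y : M x) (n : N x) :
  tensor (a *: y) n = a *: tensor y n.
Proof.
apply/eqP; rewrite -subr_eq0 /tensor -linearZ -raddfB; apply/eqP.
exact: qpi_rel0 (TensZl _ _ _).
Qed.

Lemma tensorZr M N (x : C) a (y : M x) (n : N x) :
  tensor y (a *: n) = a *: tensor y n.
Proof.
apply/eqP; rewrite -subr_eq0 /tensor -linearZ -raddfB; apply/eqP.
exact: qpi_rel0 (TensZr _ _ _).
Qed.

Lemma tensor_balanced M N (x x' : C) (f : hom x x') (y : M x') (n : N x) :
  tensor y (cm_map N f n) =
  tensor (cm_map M (f : @hom (opposite C) x' x) y) n.
Proof.
by apply/eqP; rewrite -subr_eq0 -raddfB; apply/eqP; exact: qpi_rel0 (TensBal _ _ _).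
Qed.

Lemma tensor_linear_l M N (x : C) (n : N x) : linear (fun y : M x => tensor y n).
Proof. by move=> a y y'; rewrite tensorDl tensorZl. Qed.

Definition tensor_l M N (x : C) (n : N x) : {linear M x -> tens M N} :=
  HB.pack (fun y : M x => tensor y n)
    (GRing.isLinear.Build k (M x) (tens M N) *:%R _ (@tensor_linear_l M N x n)).

Lemma tens_map_id M N u : tens_map (cmod_id M) N u = u.
Proof. by apply: (tens_lin_ext (g := idfun)) u => x y n; rewrite tens_mapE. Qed.

Lemma tens_map_comp M M' M'' N (g : cmod_hom M' M'') (f : cmod_hom M M') u :
  tens_map (cmod_comp g f) N u = tens_map g N (tens_map f N u).
Proof.
apply: (tens_lin_ext (g := tens_map g N \o tens_map f N)) u => x y n.
by rewrite -[RHS]/(tens_map g N (tens_map f N (tensor y n))) !tens_mapE.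
Qed.

Lemma tens_map_sub M M' N (g f : cmod_hom M M') u :
  tens_map (cmod_sub g f) N u = tens_map g N u - tens_map f N u.
Proof.
apply: (tens_lin_ext (g := tens_map g N \- tens_map f N)) u => x y n.
rewrite -[RHS]/(tens_map g N (tensor y n) - tens_map f N (tensor y n)) !tens_mapE.
exact: (raddfB (tensor_l M' n)).
Qed.

Lemma tens_map_zero M M' N u : tens_map (cmod_zero M M') N u = 0.
Proof.
by apply: (tens_lin_ext (g := \0)) u => x y n; rewrite tens_mapE tensor0l.
Qed.

Lemma eq_tens_map M M' N (g f : cmod_hom M M') :
  (forall x v, g x v = f x v) -> tens_map g N =1 tens_map f N.
Proof. by move=> gf; apply: tens_lin_ext => x y n; rewrite !tens_mapE gf. Qed.
End TensorCalculus.

Section TensorLift.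
Variables (k : comPzRingType) (C : category).
Variables (M : contra_cmodule k C) (N : cmodule k C) (W : lmodType k).
Variable phi : forall x : C, N x -> {linear M x -> W}.
Arguments phi {x} _.
Hypothesis phiD : forall (x : C) (n n' : N x) y, phi (n + n') y = phi n y + phi n' y.
Hypothesis phiZ : forall (x : C) a (n : N x) y, phi (a *: n) y = a *: phi n y.
Hypothesis phi_bal : forall (x x' : C) (f : hom x x') (n : N x) (y : M x'),
  phi (cm_map N f n) y = phi n (cm_map M (f : @hom (opposite C) x' x) y).

Fact tens_lift_subproof v : tens_rel v ->
  flift (fun g : tens_gen M N => phi (tagged g).2 (tagged g).1) v = 0.
Proof.
pose L : {linear _ -> W} :=
  flift (fun g : tens_gen M N => phi (tagged g).2 (tagged g).1).
have E x (y : M x) (n : N x) : L (egen y n) = phi n y by exact: flift_gen.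
rewrite -[flift _ v]/(L v).
case=> {v} [x y y' n|x y n n'|x a y n|x a y n|x x' f y n].
- by rewrite 2!(linearB L) !E raddfD -addrA -opprD subrr.
- by rewrite 2!(linearB L) !E phiD -addrA -opprD subrr.
- by rewrite (linearB L) (linearZ_LR L) !E linearZ_LR subrr.
- by rewrite (linearB L) (linearZ_LR L) !E phiZ subrr.
- by rewrite (linearB L) !E phi_bal subrr.
Qed.

Definition tens_lift : {linear tens M N -> W} := qlift_lin tens_lift_subproof.

Lemma tens_liftE (x : C) (y : M x) (n : N x) : tens_lift (tensor y n) = phi n y.
Proof.
transitivity (flift (fun g : tens_gen M N => phi (tagged g).2 (tagged g).1)
  (egen y n)); last exact: flift_gen.
exact: (qliftE tens_lift_subproof).
Qed.
End TensorLift.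

Section TensorComplex.
Variables (k : comPzRingType) (C : category) (N : cmodule k C).
Implicit Types Z : cmod_complex k (opposite C).

Fact tens_cx_diffK Z n (u : tens (Z n.+3 : contra_cmodule k C) N) :
  tens_map (cx_diff Z n.+1) N (tens_map (cx_diff Z n.+2) N u) = 0.
Proof.
rewrite -tens_map_comp -[RHS](tens_map_zero (Z n.+1) u).
by apply: eq_tens_map => x v; apply: cx_diffK.
Qed.

(** Degree 0 of [Z], which holds the resolved module, is dropped. *)
Definition tens_cx Z : chain_complex k :=
  @ChainComplex k (fun n => tens (Z n.+1) N)
    (fun n => tens_map (cx_diff Z n.+1) N) (@tens_cx_diffK Z).

(** In degree 0 a cycle of [tens_cx Z] is an arbitrary element, which the dropped
    differential need not kill; this is why [h 0] has to vanish. *)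
Lemma tens_null_homotopic Z Z' (f : forall n, cmod_hom (Z n) (Z' n))
    (h : forall n, cmod_hom (Z n) (Z' n.+1)) :
  h 0%N = cmod_zero _ _ ->
  (forall n x v,
    cx_diff Z' n.+1 x (h n.+1 x v) = f n.+1 x v - h n x (cx_diff Z n x v)) ->
  forall n (u : tens_cx Z n), u \in @cyclep k (tens_cx Z) n ->
  exists y, cc_diff (tens_cx Z') n y = tens_map (f n.+1) N u.
Proof.
move=> h0 hP n u cu; exists (tens_map (h n.+1) N u).
rewrite -[LHS]tens_map_comp.
rewrite (eq_tens_map (f := cmod_sub (f n.+1) (cmod_comp (h n) (cx_diff Z n))));
  last exact: hP.
rewrite tens_map_sub tens_map_comp.
case: n u cu => [|n] u cu; first by rewrite h0 tens_map_zero subr0.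
have /eqP -> : tens_map (cx_diff Z n.+1) N u == 0 by exact: cu.
by rewrite raddf0 subr0.
Qed.

Lemma tens_homotopy_inverse Z Z' (I : Type) (J : I -> opposite C)
    (f : forall n, cmod_hom (Z n) (Z' n)) (g : forall n, cmod_hom (Z' n) (Z n)) :
  (forall n, lifts J (Z n.+1)) -> (forall i, exact_at Z (J i)) ->
  is_chain_map f -> is_chain_map g -> (forall x v, g 0%N x (f 0%N x v) = v) ->
  forall n (u : tens_cx Z n), u \in @cyclep k (tens_cx Z) n ->
  exists y, cc_diff (tens_cx Z) n y =
    tens_map (g n.+1) N (tens_map (f n.+1) N u) - u.
Proof.
move=> lZ eZ fd gd gf0.
pose p n := cmod_sub (cmod_comp (g n) (f n)) (cmod_id (Z n)).
have pd : is_chain_map p by move=> n x v; rewrite /= raddfB /= gd fd.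
have p0 x v : p 0%N x v = 0 by rewrite /= gf0 subrr.
have [h [h0 hP]] := chain_homotopy lZ eZ pd p0.
move=> n u cu; have [y yu] := tens_null_homotopic h0 hP cu.
by exists y; rewrite yu tens_map_sub tens_map_comp tens_map_id.
Qed.

(** The comparison theorem: two resolutions of isomorphic modules have homotopy
    equivalent, hence isomorphic, tensor complexes. *)
Lemma tens_comparison Z Z' (I I' : Type) (J : I -> opposite C) (J' : I' -> opposite C)
    (f0 : cmod_hom (Z 0%N) (Z' 0%N)) (g0 : cmod_hom (Z' 0%N) (Z 0%N)) :
  (forall n, lifts J (Z n.+1)) -> (forall x, exact_at Z x) ->
  (forall n, lifts J' (Z' n.+1)) -> (forall x, exact_at Z' x) ->
  (forall x v, g0 x (f0 x v) = v) -> (forall x v, f0 x (g0 x v) = v) ->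
  forall n, lmod_iso (homology (tens_cx Z) n) (homology (tens_cx Z') n).
Proof.
move=> lZ eZ lZ' eZ' gf fg n.
have [f [f0E fd]] := chain_lift lZ (fun i => eZ' (J i)) f0.
have [g [g0E gd]] := chain_lift lZ' (fun i => eZ (J' i)) g0.
have td Z1 Z2 (h : forall n, cmod_hom (Z1 n) (Z2 n)) (hd : is_chain_map h) m u :
    tens_map (h m.+1) N (cc_diff (tens_cx Z1) m u) =
    cc_diff (tens_cx Z2) m (tens_map (h m.+2) N u).
  rewrite -[LHS]tens_map_comp -[RHS]tens_map_comp.
  by apply: eq_tens_map => x v /=; rewrite hd.
apply: (@homology_iso k (tens_cx Z) (tens_cx Z')
  (fun m => tens_map (f m.+1) N) (fun m => tens_map (g m.+1) N)).
- exact: td.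
- exact: td.
- apply: tens_homotopy_inverse lZ (fun i => eZ (J i)) fd gd _.
  by rewrite f0E g0E.
- apply: tens_homotopy_inverse lZ' (fun i => eZ' (J' i)) gd fd _.
  by rewrite f0E g0E.
Qed.
End TensorComplex.

Section ResolutionComplex.
Variables (k : comPzRingType) (C : category) (M : cmodule k C).
Variable P : proj_resolution M.

Definition res_cx_ob n : cmodule k C := if n is m.+1 then P m else M.
Definition res_cx_diff n : cmod_hom (res_cx_ob n.+1) (res_cx_ob n) :=
  match n with 0 => res_aug P | m.+1 => res_diff P m end.

Fact res_cx_diffK n x v : res_cx_diff n x (res_cx_diff n.+1 x v) = 0.
Proof.
by case: n v => [|n] v; [apply/res_exact0 | apply/res_exactS]; exists v.
Qed.
Definition res_cx : cmod_complex k C := CModComplex res_cx_diffK.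

Lemma res_cx_exact x : exact_at res_cx x.
Proof.
split=> [v|[|n] v]; first exact: res_aug_epi.
  by move/res_exact0.
by move/res_exactS.
Qed.

Lemma res_cx_lifts n : lifts id (res_cx n.+1).
Proof. exact/projective_lifts/res_proj. Qed.
End ResolutionComplex.

Lemma tens_res_cx (k : comPzRingType) (C : category) (M : contra_cmodule k C)
    (N : cmodule k C) (P : proj_resolution M) :
  tens_cx N (res_cx P) = tens_complex N P.
Proof. exact: chain_complex_eq. Qed.

(** * The complex of a functor *)

Section Bar.
Variables (k : comPzRingType) (C D : category) (j : cfunctor C D).

(** The diagrams d -> j x_0, x_0 -> ... -> x_p are the p-simplices of the nerve of
    the comma category d | j, the other arrows d -> j x_i being determined. *)
Definition bar (p : nat) (d : D) : Type := {x : C & (hom d (j x) * string p x)%type}.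

Definition mk_bar p d x (f : hom d (j x)) (t : string p x) : bar p d :=
  existT (fun x => (hom d (j x) * string p x)%type) x (f, t).

Definition bar_act p c d (a : hom c d) (s : bar p d) : bar p c :=
  mk_bar ((tagged s).1 \oc a) (tagged s).2.

Definition bar_face p i d (s : bar p.+1 d) : bar p d :=
  if i is i'.+1 then mk_bar (tagged s).1 (string_face i' (tagged s).2)
  else let: existT y (g, t) := (tagged s).2 in
    mk_bar (cf_map j g \oc (tagged s).1) t.

Lemma bar_faceK p i i' d (s : bar p.+2 d) : (i < i')%N ->
  bar_face i (bar_face i' s) = bar_face i'.-1 (bar_face i s).
Proof.
case: i' => // i'; case: i => [_|i ii'].
  case: s => x [f [y [g [z [h t]]]]]; case: i' => [|i'] //=.
  by rewrite /bar_face /= cf_comp compA.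
case: s => x [f t]; case: i' ii' => // i' ii'.
exact: (congr1 (mk_bar f) (@string_faceK C p i i'.+1 x t ii')).
Qed.

Lemma bar_act_face p i c d (a : hom c d) (s : bar p.+1 d) :
  bar_face i (bar_act a s) = bar_act a (bar_face i s).
Proof.
case: i => [|i] //; case: s => x [f [y [g t]]].
by rewrite /bar_face /bar_act /= compA.
Qed.

Program Definition bar_module (p : nat) : contra_cmodule k D :=
  @CModule k (opposite D) (fun d : D => freemod k (bar p d))
    (fun (d c : D) (a : @hom D c d) => free_map k (bar_act a)) _ _.
Next Obligation.
move=> p d; apply: (free_lin_ext (h := idfun)) => -[x [f t]].
by rewrite free_map_gen /bar_act /= comp_idr.
Qed.
Next Obligation.
move=> p e d c b a; apply: (free_lin_ext (h := free_map k (bar_act b) \o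
  free_map k (bar_act a))) => -[x [f t]].
by rewrite -[RHS]/(free_map _ _ (free_map _ _ _)) !free_map_gen /bar_act /= compA.
Qed.

Program Definition bar_simp (d : D) : simp_module k :=
  @SimpModule k (fun p => freemod k (bar p d))
    (fun p i => free_map k (@bar_face p i d)) _.
Next Obligation.
move=> d p i i' v /andP[ii' _].
apply: (free_lin_ext (g := free_map k (@bar_face p i d) \o
    free_map k (@bar_face p.+1 i' d))
  (h := free_map k (@bar_face p i'.-1 d) \o free_map k (@bar_face p.+1 i d))) => s.
rewrite -[LHS]/(free_map _ _ (free_map _ _ _)).
by rewrite -[RHS]/(free_map _ _ (free_map _ _ _)) !free_map_gen bar_faceK.
Qed.

Definition bar_diff_at p d : {linear bar_module p.+1 d -> bar_module p d} :=
  cc_diff (alt_complex (bar_simp d)) p.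

Lemma bar_diff_atE p d s : bar_diff_at p d (fgen k s) =
  \sum_(i < p.+2) (-1) ^+ i *: (fgen k (bar_face i s)).
Proof.
rewrite /= /alt_diff; apply: eq_bigr => i _; congr (_ *: _).
exact: free_map_gen.
Qed.

Program Definition bar_diff p : cmod_hom (bar_module p.+1) (bar_module p) :=
  @CModHom k (opposite D) (bar_module p.+1) (bar_module p) (bar_diff_at p) _.
Next Obligation.
move=> p d c a; apply: (free_lin_ext
  (g := bar_diff_at p c \o free_map k (bar_act a))
  (h := free_map k (bar_act a) \o bar_diff_at p d)) => s.
rewrite -[LHS]/(bar_diff_at p c (free_map k (bar_act a) (fgen k s))).
rewrite -[RHS]/(free_map k (bar_act a) (bar_diff_at p d (fgen k s))).
rewrite free_map_gen !bar_diff_atE linear_sum; apply: eq_bigr => i _.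
by rewrite linearZ free_map_gen bar_act_face.
Qed.

Program Definition bar_aug : cmod_hom (bar_module 0) (const_module k (opposite D)) :=
  @CModHom k (opposite D) (bar_module 0) (const_module k (opposite D))
    (fun d : D => @flift k (bar 0 d) k^o (fun _ => 1)) _.
Next Obligation.
move=> d c a.
apply: (free_lin_ext (g := @flift k (bar 0 c) k^o (fun _ => 1) \o
  free_map k (bar_act a)) (h := @flift k (bar 0 d) k^o (fun _ => 1))) => s.
rewrite -[LHS]/(flift _ (free_map _ _ _)).
rewrite free_map_gen -[RHS]/(@flift k _ k^o (fun _ => 1) (fgen k s)).
by rewrite !flift_gen.
Qed.

Definition bar_cx_ob n : contra_cmodule k D :=
  if n is p.+1 then bar_module p else const_module k (opposite D).
Definition bar_cx_diff n : cmod_hom (bar_cx_ob n.+1) (bar_cx_ob n) :=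
  match n with 0 => bar_aug | p.+1 => bar_diff p end.

Fact bar_cx_diffK n d v : bar_cx_diff n d (bar_cx_diff n.+1 d v) = 0.
Proof.
case: n v => [|n] v; last exact: (@alt_diffK k (bar_simp d) n).
apply: (free_lin_ext (g := bar_aug d \o bar_diff 0 d) (h := \0)) v => s.
rewrite -[LHS]/(bar_aug d (bar_diff_at 0 d (fgen k s))) bar_diff_atE.
rewrite linear_sum !big_ord_recl big_ord0 /= !linearZ_LR /= !flift_gen.
by rewrite expr0 expr1 scaleN1r scale1r addr0 subrr.
Qed.

Definition bar_cx : cmod_complex k (opposite D) := CModComplex bar_cx_diffK.

(** A diagram d -> j x_0, x_0 -> ... is the restriction along d -> j x_0 of the one
    that starts with the identity of j x_0.  These are therefore a basis, and a lift
    may be chosen freely on it. *)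
Lemma bar_lifts p :
  @lifts k (opposite D) C (fun x => j x) (bar_module p).
Proof.
move=> M N e f fe.
pose lift x (t : string p x) := cid (fe x (fgen k (mk_bar (idm (j x)) t))).
pose g (d : D) : {linear bar_module p d -> M d} :=
  flift (fun s : bar p d =>
    cm_map M ((tagged s).1 : @hom (opposite D) (j (tag s)) d)
      (sval (lift (tag s) (tagged s).2))).
have gE d x (h : hom d (j x)) t : g d (fgen k (mk_bar h t)) =
    cm_map M (h : @hom (opposite D) (j x) d) (sval (lift x t)).
  exact: flift_gen.
have g_nat (d c : opposite D) (a : hom d c) v :
    g c (cm_map (bar_module p) a v) = cm_map M a (g d v).
  apply: (free_lin_ext (g := g c \o cm_map (bar_module p) a)
    (h := cm_map M a \o g d)) => -[x [h t]].
  rewrite -[LHS]/(g c (free_map k (bar_act a) (fgen k (mk_bar h t)))) free_map_gen.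
  rewrite -[RHS]/(cm_map M a (g d (fgen k (mk_bar h t)))) !gE.
  by rewrite -cm_comp.
exists (CModHom g_nat) => d v.
apply: (free_lin_ext (g := e d \o g d) (h := f d)) => -[x [h t]].
rewrite -[LHS]/(e d (g d (fgen k (mk_bar h t)))) gE nt_natural.
rewrite (svalP (lift x t)) -nt_natural.
rewrite -[cm_map _ _ _]/(free_map k (bar_act h) _) free_map_gen.
by rewrite /bar_act /= comp_idl.
Qed.

(** Coning off with apex a : d -> j y.  A diagram d -> j x_0 -> ... is first moved by
    G, and the arrows b join the apex to the result.  For G = id and b = id this is the
    contraction of a category with an initial object. *)
Section Cone.
Variables (G : cfunctor C C) (d : D) (y : C) (a : hom d (j y)).
Variable b : forall x, hom d (j x) -> hom y (G x).
Hypothesis b_nat : forall x x' (g : hom x x') (f : hom d (j x)),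
  cf_map G g \oc b f = b (cf_map j g \oc f).

Definition bar_shift p (s : bar p d) : bar p d :=
  mk_bar (cf_map j (b (tagged s).1) \oc a) (string_map G (tagged s).2).

Definition bar_cone p (s : bar p d) : bar p.+1 d :=
  @mk_bar p.+1 d y a (existT (fun z => (hom y z * string p z)%type) (G (tag s))
    (b (tagged s).1, string_map G (tagged s).2)).

Lemma bar_cone_face0 p (s : bar p d) : bar_face 0 (bar_cone s) = bar_shift s.
Proof. by []. Qed.

Lemma bar_cone_faceS p i (s : bar p.+1 d) :
  bar_face i.+1 (bar_cone s) = bar_cone (bar_face i s).
Proof.
case: s => x [f t]; case: i => [|i].
  by case: t => x' [g t]; rewrite /bar_face /bar_cone /= b_nat.
pose cons u := @mk_bar p.+1 d y a
  (existT (fun z => (hom y z * string p z)%type) (G x) (b f, u)).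
exact: (congr1 cons (esym (string_map_face G i t))).
Qed.

(** The cone is a chain homotopy from 0 to the shift, since its face 0 is the
    shift and its other faces are the cones of the faces. *)
Lemma bar_shift_boundary n (v : bar_cx n.+1 d) : cx_diff bar_cx n d v = 0 ->
  exists u, cx_diff bar_cx n.+1 d u = free_map k (@bar_shift n) v.
Proof.
move=> dv; exists (free_map k (@bar_cone n) v).
case: n v dv => [|n] v dv.
  (* The face of the cone of a 0-simplex opposite to its base is the apex alone,
     so the augmentation stands in for the differential. *)
  rewrite -[RHS]subr0 -[X in _ - X](scale0r (fgen k (@mk_bar 0 d y a tt))) -dv.
  pose z (c : k^o) := (c : k) *: fgen k (@mk_bar 0 d y a tt).
  have z_lin : linear z by move=> c c1 c2; rewrite /z scalerDl scalerA.
  pose zL : {linear k^o -> bar_module 0 d} :=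
    HB.pack z (GRing.isLinear.Build k k^o (bar_module 0 d) *:%R z z_lin).
  apply: (free_lin_ext (g := bar_diff_at 0 d \o free_map k (@bar_cone 0))
    (h := free_map k (@bar_shift 0) \- (zL \o bar_aug d))) => s.
  rewrite -[LHS]/(bar_diff_at 0 d (free_map k (@bar_cone 0) (fgen k s))).
  rewrite -[RHS]/(free_map k (@bar_shift 0) (fgen k s) - z (flift _ (fgen k s))).
  rewrite !free_map_gen flift_gen bar_diff_atE !big_ord_recl big_ord0 /=.
  by rewrite expr0 expr1 scaleN1r !scale1r addr0 /z scale1r.
rewrite -[RHS]subr0 -(raddf0 (free_map k (@bar_cone n))) -dv.
apply: (free_lin_ext (g := bar_diff_at n.+1 d \o free_map k (@bar_cone n.+1))
  (h := free_map k (@bar_shift n.+1) \- (free_map k (@bar_cone n) \o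
    bar_diff_at n d))) => s.
rewrite -[LHS]/(bar_diff_at n.+1 d (free_map k (@bar_cone n.+1) (fgen k s))).
rewrite -[RHS]/(free_map k (@bar_shift n.+1) (fgen k s) -
  free_map k (@bar_cone n) (bar_diff_at n d (fgen k s))).
rewrite !free_map_gen !bar_diff_atE (linear_sum (free_map k (@bar_cone n))).
rewrite big_ord_recl expr0 scale1r.
rewrite bar_cone_face0 -sumrN; congr (_ + _); apply: eq_bigr => i _.
by rewrite linearZ free_map_gen -bar_cone_faceS exprS -scalerA scaleN1r.
Qed.
End Cone.

Lemma bar_aug_epi (d : D) (v : bar_cx 0 d) : (exists y, inhabited (hom d (j y))) ->
  exists u, cx_diff bar_cx 0 d u = v.
Proof.
case=> y [a]; exists ((v : k) *: fgen k (@mk_bar 0 d y a tt)).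
by rewrite linearZ_LR /= flift_gen; apply: mulr1.
Qed.

(** The endomorphism of the complex induced by a natural map id -> G. *)
Section Translate.
Variables (G : cfunctor C C) (eta : forall x, hom x (G x)).
Hypothesis eta_nat : forall x x' (g : hom x x'),
  cf_map G g \oc eta x = eta x' \oc g.

Definition bar_push p d (s : bar p d) : bar p d :=
  mk_bar (cf_map j (eta (tag s)) \oc (tagged s).1) (string_map G (tagged s).2).

Lemma bar_push_face p i d (s : bar p.+1 d) :
  bar_face i (bar_push s) = bar_push (bar_face i s).
Proof.
case: s => x [f t]; case: i => [|i].
  by case: t => y [g t]; rewrite /bar_face /bar_push /= !compA -!cf_comp eta_nat.
exact: (congr1 (mk_bar _) (esym (string_map_face G i t))).
Qed.

Program Definition bar_push_module p : cmod_hom (bar_module p) (bar_module p) :=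
  @CModHom k (opposite D) (bar_module p) (bar_module p)
    (fun d : D => free_map k (@bar_push p d)) _.
Next Obligation.
move=> p d c a.
apply: (free_lin_ext (g := free_map k (@bar_push p c) \o free_map k (bar_act a))
  (h := free_map k (bar_act a) \o free_map k (@bar_push p d))) => s.
rewrite -[LHS]/(free_map _ _ (free_map _ _ _)).
rewrite -[RHS]/(free_map _ _ (free_map _ _ _)) !free_map_gen.
by rewrite /bar_push /bar_act /= compA.
Qed.

Definition bar_push_cx n : cmod_hom (bar_cx n) (bar_cx n) :=
  match n with 0 => cmod_id _ | p.+1 => bar_push_module p end.

Lemma bar_push_chain : is_chain_map bar_push_cx.
Proof.
case=> [|n] d v.
  apply: (free_lin_ext (g := bar_aug d \o free_map k (@bar_push 0 d))
    (h := bar_aug d)) => s.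
  rewrite -[LHS]/(@flift k _ k^o (fun _ => 1) (free_map k _ (fgen k s))).
  rewrite free_map_gen.
  by rewrite -[RHS]/(@flift k _ k^o (fun _ => 1) (fgen k s)) !flift_gen.
apply: (free_lin_ext (g := bar_diff_at n d \o free_map k (@bar_push n.+1 d))
  (h := free_map k (@bar_push n d) \o bar_diff_at n d)) => s.
rewrite -[LHS]/(bar_diff_at n d (free_map k _ (fgen k s))) free_map_gen.
rewrite -[RHS]/(free_map k (@bar_push n d) (bar_diff_at n d (fgen k s))).
rewrite !bar_diff_atE (linear_sum (free_map k (@bar_push n d))).
by apply: eq_bigr => i _; rewrite linearZ free_map_gen bar_push_face.
Qed.

(** Natural maps x -> G x <- y contract the nerve of d | j.  The endomorphism
    [bar_push_cx] is homotopic to the identity because both lift the identity of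
    the constant functor, and because exactness at the objects [j x] suffices to
    build the homotopy; at [d] it coincides with the shift of the cone, which sends
    cycles to boundaries. *)
Lemma bar_exact_translate (d : D) (y : C) (a : hom d (j y))
    (b : forall x, hom d (j x) -> hom y (G x)) :
  (forall x x' (g : hom x x') (f : hom d (j x)),
     cf_map G g \oc b x f = b x' (cf_map j g \oc f)) ->
  (forall x (f : hom d (j x)), cf_map j (b x f) \oc a = cf_map j (eta x) \oc f) ->
  (forall x : C, exact_at bar_cx (j x)) -> exact_at bar_cx d.
Proof.
move=> b_nat b_eta ex_j; split=> [v|n v dv].
  by apply: bar_aug_epi; exists y; split.
pose p n := cmod_sub (bar_push_cx n) (cmod_id (bar_cx n)).
have pd : is_chain_map p.
  by move=> m x w; rewrite /= raddfB /= bar_push_chain.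
have p0 x w : p 0%N x w = 0 by rewrite /= subrr.
have [h [_ hP]] := @chain_homotopy k (opposite D) bar_cx bar_cx C (fun x => j x)
  bar_lifts ex_j p pd p0.
have [u uP] := bar_shift_boundary a b_nat dv.
exists (u - h n.+1 d v); rewrite raddfB /= uP hP dv raddf0 subr0 /=.
have -> : free_map k (bar_shift a b (p := n)) v = free_map k (@bar_push n d) v.
  by congr (free_map k _ v); apply/funext => s; rewrite /bar_shift b_eta.
by rewrite opprB addrC subrK.
Qed.
End Translate.

Lemma string_map_id p (x : C) (t : string p x) :
  string_map (cfunctor_id C) t = t.
Proof. exact: existT_inj (nerve_map_id (existT _ x t)). Qed.

(** When j is fully faithful, the identity of j y is initial in j y | j. *)
Lemma bar_exact_full_faithful :
  (forall x y, {r : hom (j x) (j y) -> hom x y |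
    cancel r (@cf_map _ _ j x y) & cancel (@cf_map _ _ j x y) r}) ->
  forall y, exact_at bar_cx (j y).
Proof.
move=> ff y.
pose r x := s2val (ff y x).
have rK x : cancel (r x) (@cf_map _ _ j y x) := s2valP (ff y x).
have Kr x : cancel (@cf_map _ _ j y x) (r x) := s2valP' (ff y x).
have r_nat x x' (g : hom x x') (f : hom (j y) (j x)) :
    cf_map (cfunctor_id C) g \oc r x f = r x' (cf_map j g \oc f).
  by apply: (can_inj (Kr x')); rewrite cf_comp !rK.
split=> [v|n v dv].
  by apply: bar_aug_epi; exists y; split; apply: idm.
have [u uP] := bar_shift_boundary (idm (j y)) r_nat dv.
exists u; rewrite uP; apply: (free_lin_ext (h := idfun)) => s.
rewrite free_map_gen; congr (fgen k _); case: s => x [f t].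
by rewrite /bar_shift /= rK comp_idr string_map_id.
Qed.
End Bar.

Section BarResolution.
Variables (k : comPzRingType) (C : category).

Notation "1C" := (cfunctor_id C).

Lemma bar_id_exact (c : C) : exact_at (bar_cx k 1C) c.
Proof.
apply: (@bar_exact_full_faithful k C C 1C) => x y.
by exists id.
Qed.

Lemma bar_id_lifts p : lifts id (bar_cx k 1C p.+1).
Proof. exact: bar_lifts. Qed.

Definition bar_resolution : proj_resolution (const_module k (opposite C)).
Proof.
refine (@ProjResolution k (opposite C) (const_module k (opposite C))
  (bar_module k 1C) (bar_diff k 1C) (bar_aug k 1C) _ _ _ _).
- by move=> p; apply/lifts_projective/bar_id_lifts.
- by move=> c v; case: (bar_id_exact c) => + _; apply.
- move=> c v; split=> [|[u <-]]; first by case: (bar_id_exact c) => _ /(_ 0%N); apply.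
  exact: (bar_cx_diffK (n := 0) u).
- move=> n c v; split=> [|[u <-]].
    by case: (bar_id_exact c) => _ /(_ n.+1); apply.
  exact: (bar_cx_diffK (n := n.+1) u).
Defined.
End BarResolution.

(** * Change of category *)

Program Definition cmod_pull (k : comPzRingType) (C D : category)
    (j : cfunctor C D) (N : cmodule k D) : cmodule k C :=
  @CModule k C (fun x => N (j x)) (fun x y f => cm_map N (cf_map j f)) _ _.
Next Obligation. by move=> k C D j N x v; rewrite /= cf_id cm_id. Qed.
Next Obligation. by move=> k C D j N x y z g f v; rewrite /= cf_comp cm_comp. Qed.

(** Sliding the arrow d -> j x_0 of a diagram across the tensor product leaves only
    the string x_0 -> ... -> x_p, tensored with an element of N(j x_0).  This
    description does not mention D, whence an isomorphism between the tensor
    products over C and over D. *)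
Section ChangeOfCategory.
Variables (k : comPzRingType) (C D : category) (j : cfunctor C D).
Variable N : cmodule k D.

Notation "1C" := (cfunctor_id C).

Definition bar_image p (c : C) (s : bar 1C p c) : bar j p (j c) :=
  mk_bar (cf_map j (tagged s).1) (tagged s).2.

Lemma bar_image_face p i c (s : bar 1C p.+1 c) :
  bar_face i (bar_image s) = bar_image (bar_face i s).
Proof.
case: i => [|i] //; case: s => x [f [y [g t]]].
by rewrite /bar_face /bar_image /= cf_comp.
Qed.

Definition bar_image_lin p (c : C) :
    {linear bar_module k 1C p c -> bar_module k j p (j c)} :=
  free_map k (@bar_image p c).

Lemma bar_image_diff p (c : C) v :
  bar_image_lin p c (bar_diff k 1C p c v) = bar_diff k j p (j c) (bar_image_lin p.+1 c v).
Proof.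
apply: (free_lin_ext (g := bar_image_lin p c \o bar_diff_at k 1C p c)
  (h := bar_diff_at k j p (j c) \o bar_image_lin p.+1 c)) => s.
rewrite -[LHS]/(bar_image_lin p c (bar_diff_at k 1C p c (fgen k s))).
rewrite -[RHS]/(bar_diff_at k j p (j c) (free_map k (@bar_image p.+1 c) (fgen k s))).
rewrite free_map_gen !bar_diff_atE (linear_sum (bar_image_lin p c)).
apply: eq_bigr => i _; rewrite linearZ_LR bar_image_face; congr (_ *: _).
exact: free_map_gen.
Qed.

Definition tens_push_at p (c : C) (n : cmod_pull j N c) :
    {linear bar_module k 1C p c -> tens (bar_module k j p) N} :=
  @tensor_l k D (bar_module k j p) N (j c) n \o bar_image_lin p c.

Fact tens_push_atD p (c : C) (n n' : cmod_pull j N c) y :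
  tens_push_at p (n + n') y = tens_push_at p n y + tens_push_at p n' y.
Proof. exact: tensorDr. Qed.

Fact tens_push_atZ p (c : C) a (n : cmod_pull j N c) y :
  tens_push_at p (a *: n) y = a *: tens_push_at p n y.
Proof. exact: tensorZr. Qed.

Fact tens_push_at_bal p (x x' : C) (f : hom x x') (n : cmod_pull j N x)
    (y : bar_module k 1C p x') :
  tens_push_at p (cm_map (cmod_pull j N) f n) y =
  tens_push_at p n (cm_map (bar_module k 1C p) (f : @hom (opposite C) x' x) y).
Proof.
rewrite -[LHS]/(tensor _ _) -[RHS]/(tensor _ _) /= tensor_balanced.
congr (tensor _ _).
apply: (free_lin_ext (g := free_map k (bar_act (cf_map j f)) \o bar_image_lin p x')
  (h := bar_image_lin p x \o free_map k (bar_act f))) => s.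
rewrite -[LHS]/(free_map _ _ (free_map _ _ _)).
rewrite -[RHS]/(free_map _ _ (free_map _ _ _)) !free_map_gen.
by rewrite /bar_act /bar_image /= cf_comp.
Qed.

Definition tens_push p :
    {linear tens (bar_module k 1C p) (cmod_pull j N) -> tens (bar_module k j p) N} :=
  tens_lift (@tens_push_atD p) (@tens_push_atZ p) (@tens_push_at_bal p).

Definition tens_pull_at p (d : D) (n : N d) :
    {linear bar_module k j p d -> tens (bar_module k 1C p) (cmod_pull j N)} :=
  flift (fun s : bar j p d =>
    @tensor k C (bar_module k 1C p) (cmod_pull j N) (tag s)
      (fgen k (@mk_bar _ _ 1C p (tag s) (tag s) (idm (tag s)) (tagged s).2))
      (cm_map N (tagged s).1 n)).

Lemma tens_pull_atE p (d : D) (n : N d) x (f : hom d (j x)) t :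
  tens_pull_at p n (fgen k (mk_bar f t)) =
  @tensor k C (bar_module k 1C p) (cmod_pull j N) x
    (fgen k (@mk_bar _ _ 1C p x x (idm x) t)) (cm_map N f n).
Proof. exact: flift_gen. Qed.

Fact tens_pull_atD p (d : D) (n n' : N d) y :
  tens_pull_at p (n + n') y = tens_pull_at p n y + tens_pull_at p n' y.
Proof.
apply: (free_lin_ext (h := tens_pull_at p n \+ tens_pull_at p n')) => -[x [f t]].
rewrite -[RHS]/(tens_pull_at p n (fgen k (mk_bar f t)) +
  tens_pull_at p n' (fgen k (mk_bar f t))).
by rewrite !tens_pull_atE raddfD; apply: tensorDr.
Qed.

Fact tens_pull_atZ p (d : D) a (n : N d) y :
  tens_pull_at p (a *: n) y = a *: tens_pull_at p n y.
Proof.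
apply: (free_lin_ext (h := a \*: tens_pull_at p n)) => -[x [f t]].
rewrite -[RHS]/(a *: tens_pull_at p n (fgen k (mk_bar f t))).
by rewrite !tens_pull_atE linearZ_LR; apply: tensorZr.
Qed.

Fact tens_pull_at_bal p (d d' : D) (f : hom d d') (n : N d)
    (y : bar_module k j p d') :
  tens_pull_at p (cm_map N f n) y =
  tens_pull_at p n (cm_map (bar_module k j p) (f : @hom (opposite D) d' d) y).
Proof.
apply: (free_lin_ext (h := tens_pull_at p n \o free_map k (bar_act f))) => -[x [g t]].
rewrite -[RHS]/(tens_pull_at p n (free_map k (bar_act f) (fgen k (mk_bar g t)))).
by rewrite free_map_gen !tens_pull_atE cm_comp.
Qed.

Definition tens_pull p :
    {linear tens (bar_module k j p) N -> tens (bar_module k 1C p) (cmod_pull j N)} :=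
  tens_lift (@tens_pull_atD p) (@tens_pull_atZ p) (@tens_pull_at_bal p).

Lemma tens_pushE p (c : C) (y : bar_module k 1C p c) (n : cmod_pull j N c) :
  tens_push p (tensor y n) =
  @tensor k D (bar_module k j p) N (j c) (bar_image_lin p c y) n.
Proof. exact: tens_liftE. Qed.

Lemma tens_pullE p (d : D) (y : bar_module k j p d) (n : N d) :
  tens_pull p (tensor y n) = tens_pull_at p n y.
Proof. exact: tens_liftE. Qed.

Lemma tens_pushK p : cancel (tens_push p) (tens_pull p).
Proof.
apply: (tens_lin_ext (f := tens_pull p \o tens_push p) (g := idfun)) => c y n.
rewrite -[LHS]/(tens_pull p (tens_push p (tensor y n))) tens_pushE tens_pullE.
apply: (free_lin_ext (g := tens_pull_at p (n : N (j c)) \o bar_image_lin p c)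
  (h := tensor_l (bar_module k 1C p) n)) y => -[x [f t]].
rewrite -[LHS]/(tens_pull_at p (n : N (j c)) (free_map k (@bar_image p c) (fgen k _))).
rewrite free_map_gen tens_pull_atE.
rewrite (@tensor_balanced k C (bar_module k 1C p) (cmod_pull j N) c x f).
rewrite -[LHS]/(@tensor k C (bar_module k 1C p) (cmod_pull j N) c
  (free_map k (bar_act f) (fgen k (@mk_bar _ _ 1C p x x (idm x) t))) n).
by rewrite free_map_gen /bar_act /= comp_idl.
Qed.

Lemma tens_pullK p : cancel (tens_pull p) (tens_push p).
Proof.
apply: (tens_lin_ext (f := tens_push p \o tens_pull p) (g := idfun)) => d y n.
rewrite -[LHS]/(tens_push p (tens_pull p (tensor y n))) tens_pullE.
apply: (free_lin_ext (g := tens_push p \o tens_pull_at p n)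
  (h := tensor_l (bar_module k j p) n)) y => -[x [f t]].
rewrite -[LHS]/(tens_push p (tens_pull_at p n (fgen k (mk_bar f t)))).
rewrite tens_pull_atE tens_pushE tensor_balanced.
rewrite -[LHS]/(@tensor k D (bar_module k j p) N d (free_map k (bar_act f)
  (free_map k (@bar_image p x) (fgen k (@mk_bar _ _ 1C p x x (idm x) t)))) n).
by rewrite !free_map_gen /bar_act /bar_image /= cf_id comp_idl.
Qed.

Lemma change_of_category n :
  lmod_iso (homology (tens_cx (cmod_pull j N) (bar_cx k 1C)) n)
           (homology (tens_cx N (bar_cx k j)) n).
Proof.
apply: (@homology_iso_bij k (tens_cx (cmod_pull j N) (bar_cx k 1C))
  (tens_cx N (bar_cx k j)) tens_push) => p.
  by exists (tens_pull p); [exact: tens_pushK | exact: tens_pullK].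
apply: (tens_lin_ext (f := tens_push p \o tens_map (bar_diff k 1C p) _)
  (g := tens_map (bar_diff k j p) _ \o tens_push p.+1)) => c y m.
rewrite -[LHS]/(tens_push p (tens_map (bar_diff k 1C p) _ (tensor y m))).
rewrite -[RHS]/(tens_map (bar_diff k j p) _ (tens_push p.+1 (tensor y m))).
by rewrite tens_mapE !tens_pushE tens_mapE bar_image_diff.
Qed.
End ChangeOfCategory.

(** * The nerve of under-categories *)

(** A string in the under-category of c is a string in C together with an arrow from c to
    its first object, the arrows to the other objects being composites. *)
Section NerveBar.
Variables (k : comPzRingType) (C : category).

Notation "1C" := (cfunctor_id C).

Program Definition under_forget (c : C) : cfunctor (under c) C :=
  @CFunctor (under c) C (fun u => tag u) (fun u v a => sval a) _ _.
Next Obligation. by []. Qed.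
Next Obligation. by []. Qed.

Fixpoint string_under p (c x : C) (f : hom c x) : string p x ->
    @string (under c) p (existT (fun x => hom c x) x f) :=
  match p with
  | 0 => fun _ => tt
  | q.+1 => fun s =>
    let: existT y (g, t) := s in
    existT (fun v : under c => (@hom (under c) (existT _ x f) v * string q v)%type)
      (existT (fun x => hom c x) y (g \oc f))
      (exist (fun a : hom x y => a \oc f = g \oc f) g erefl,
       string_under (g \oc f) t)
  end.

Lemma string_underK p (c x : C) (f : hom c x) (t : string p x) :
  string_map (under_forget c) (string_under f t) = t.
Proof.
elim: p x f t => [|p IH] x f; first by case.
by case=> y [g t] /=; rewrite IH.
Qed.

Lemma string_forgetK p (c x : C) (f : hom c x)
    (t : @string (under c) p (existT (fun x => hom c x) x f)) :
  string_under f (string_map (under_forget c) t) = t.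
Proof.
elim: p x f t => [|p IH] x f; first by case.
case=> -[y h] [[g e] t]; simpl in e.
by case: _ / e t => t /=; rewrite IH.
Qed.

Definition nerve_bar p (c : C) (s : nerve (under c) p) : bar 1C p c :=
  @mk_bar _ _ 1C p c (tag (tag s)) (tagged (tag s))
    (string_map (under_forget c) (tagged s)).

Definition bar_nerve p (c : C) (s : bar 1C p c) : nerve (under c) p :=
  existT (@string (under c) p) (existT (fun x => hom c x) (tag s) (tagged s).1)
    (string_under (tagged s).1 (tagged s).2).

Lemma nerve_barK p (c : C) : cancel (@nerve_bar p c) (@bar_nerve p c).
Proof. by move=> [[x f] t]; rewrite /bar_nerve /= string_forgetK. Qed.

Lemma bar_nerveK p (c : C) : cancel (@bar_nerve p c) (@nerve_bar p c).
Proof. by move=> [x [f t]]; rewrite /nerve_bar /= string_underK. Qed.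

Lemma nerve_bar_face p i (c : C) (s : nerve (under c) p.+1) :
  bar_face i (nerve_bar s) = nerve_bar (nerve_face i s).
Proof.
case: s => -[x f] t; case: i => [|i].
  case: t => -[y h] [[g e] t]; simpl in e; move: t; rewrite /nerve_bar /bar_face /=.
  by case: _ / e => t.
exact: (congr1 (@mk_bar _ _ 1C p c x f) (esym (string_map_face (under_forget c) i t))).
Qed.

Lemma string_forget_under (c d : C) (a : hom c d) p (u : under d) (t : string p u) :
  string_map (under_forget c) (string_map (under_map a) t) =
  string_map (under_forget d) t.
Proof.
elim: p u t => [|p IH] u; first by case.
by case=> v [g t] /=; rewrite IH.
Qed.

Lemma nerve_bar_act (c d : C) (a : hom c d) p (s : nerve (under d) p) :
  nerve_bar (nerve_map (under_map a) s) = bar_act a (nerve_bar s).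
Proof.
case: s => -[x f] t.
exact: (congr1 (@mk_bar _ _ 1C p c x (f \oc a)) (string_forget_under a t)).
Qed.

Definition nerve_bar_lin p (c : C) :
    {linear nerve_module k C p c -> bar_module k 1C p c} :=
  free_map k (@nerve_bar p c).

Definition bar_nerve_lin p (c : C) :
    {linear bar_module k 1C p c -> nerve_module k C p c} :=
  free_map k (@bar_nerve p c).

Lemma nerve_bar_linK p (c : C) : cancel (nerve_bar_lin p c) (bar_nerve_lin p c).
Proof.
apply: (free_lin_ext (g := bar_nerve_lin p c \o nerve_bar_lin p c) (h := idfun)).
move=> s; rewrite -[LHS]/(free_map _ _ (free_map _ _ _)) !free_map_gen.
by rewrite nerve_barK.
Qed.

Lemma bar_nerve_linK p (c : C) : cancel (bar_nerve_lin p c) (nerve_bar_lin p c).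
Proof.
apply: (free_lin_ext (g := nerve_bar_lin p c \o bar_nerve_lin p c) (h := idfun)).
move=> s; rewrite -[LHS]/(free_map _ _ (free_map _ _ _)) !free_map_gen.
by rewrite bar_nerveK.
Qed.

Fact nerve_bar_natural p (d c : opposite C) (a : hom d c) v :
  nerve_bar_lin p c (cm_map (nerve_module k C p) a v) =
  cm_map (bar_module k 1C p) a (nerve_bar_lin p d v).
Proof.
apply: (free_lin_ext (g := nerve_bar_lin p c \o cm_map (nerve_module k C p) a)
  (h := cm_map (bar_module k 1C p) a \o nerve_bar_lin p d)) => s.
rewrite -[LHS]/(free_map _ _ (free_map _ _ _)).
rewrite -[RHS]/(free_map _ _ (free_map _ _ _)) !free_map_gen.
by rewrite nerve_bar_act.
Qed.

Definition nerve_bar_hom p : cmod_hom (nerve_module k C p) (bar_module k 1C p) :=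
  @CModHom k (opposite C) (nerve_module k C p) (bar_module k 1C p)
    (nerve_bar_lin p) (@nerve_bar_natural p).

Fact bar_nerve_natural p (d c : opposite C) (a : hom d c) v :
  bar_nerve_lin p c (cm_map (bar_module k 1C p) a v) =
  cm_map (nerve_module k C p) a (bar_nerve_lin p d v).
Proof.
apply: (can_inj (@nerve_bar_linK p c)).
by rewrite nerve_bar_natural !bar_nerve_linK.
Qed.

Definition bar_nerve_hom p : cmod_hom (bar_module k 1C p) (nerve_module k C p) :=
  @CModHom k (opposite C) (bar_module k 1C p) (nerve_module k C p)
    (bar_nerve_lin p) (@bar_nerve_natural p).

Lemma nerve_bar_diff p (c : C) (y : nerve_module k C p.+1 c) :
  bar_diff k 1C p c (nerve_bar_lin p.+1 c y) =
  \sum_(i < p.+2) (-1) ^+ i *: nerve_bar_lin p c (nerve_module_face k C p i c y).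
Proof.
apply: eq_bigr => i _; congr (_ *: _).
apply: (free_lin_ext (g := free_map k (@bar_face _ _ 1C p i c) \o nerve_bar_lin p.+1 c)
  (h := nerve_bar_lin p c \o nerve_module_face k C p i c)) => s.
rewrite -[LHS]/(free_map _ _ (free_map _ _ _)).
rewrite -[RHS]/(free_map _ _ (free_map _ _ _)) !free_map_gen.
by rewrite nerve_bar_face.
Qed.

Lemma nerve_tens_bar (N : cmodule k C) n :
  lmod_iso (homology (alt_complex (nerve_tens N)) n)
           (homology (tens_cx N (bar_cx k 1C)) n).
Proof.
apply: (@homology_iso_bij k (alt_complex (nerve_tens N))
  (tens_cx N (bar_cx k 1C)) (fun p => tens_map (nerve_bar_hom p) N)) => p.
  exists (tens_map (bar_nerve_hom p) N) => u; rewrite -tens_map_comp.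
    rewrite -[RHS](tens_map_id (M := nerve_module k C p) u).
    by apply: eq_tens_map => c v; apply: nerve_bar_linK.
  rewrite -[RHS](tens_map_id (M := bar_module k 1C p) u).
  by apply: eq_tens_map => c v; apply: bar_nerve_linK.
pose dN : {linear _ -> _} := cc_diff (alt_complex (nerve_tens N)) p.
apply: (tens_lin_ext (f := tens_map (nerve_bar_hom p) N \o dN)
  (g := tens_map (bar_diff k 1C p) N \o tens_map (nerve_bar_hom p.+1) N)) => c y m.
rewrite -[LHS]/(tens_map (nerve_bar_hom p) N (\sum_(i < p.+2) (-1) ^+ i *:
  tens_map (nerve_module_face k C p i) N (tensor y m))).
rewrite -[RHS]/(tens_map (bar_diff k 1C p) N
  (tens_map (nerve_bar_hom p.+1) N (tensor y m))).
rewrite !tens_mapE nerve_bar_diff.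
rewrite (linear_sum (tens_map (nerve_bar_hom p) N)).
rewrite -[RHS]/(tensor_l _ m (\sum_(i < p.+2) _)) linear_sum.
apply: eq_bigr => i _; rewrite !linearZ_LR; congr (_ *: _).
rewrite -[LHS]/(tens_map (nerve_bar_hom p) N
  (tens_map (nerve_module_face k C p i) N (tensor y m))).
by rewrite !tens_mapE.
Qed.
End NerveBar.

(** * Tor and an adjoined initial object *)

(** If natural maps x -> G x <- y exist, so that the nerve of C is contractible, then
    adjoining an initial object to C does not change [Tor] of the constant
    functor. *)
Section AdjoinInitialTor.
Variables (k : comPzRingType) (C : category).

Program Definition adjoin_incl : cfunctor C (adjoin_initial C) :=
  @CFunctor C (adjoin_initial C) (fun x => Some x) (fun _ _ f => f) _ _.
Next Obligation. by []. Qed.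
Next Obligation. by []. Qed.

Variables (G : cfunctor C C) (eta : forall x, hom x (G x)).
Hypothesis eta_nat : forall x x' (g : hom x x'),
  cf_map G g \oc eta x = eta x' \oc g.
Variables (y : C) (kappa : forall x, hom y (G x)).
Hypothesis kappa_nat : forall x x' (g : hom x x'),
  cf_map G g \oc kappa x = kappa x'.

Lemma bar_incl_exact (d : adjoin_initial C) : exact_at (bar_cx k adjoin_incl) d.
Proof.
have exS x : exact_at (bar_cx k adjoin_incl) (adjoin_incl x).
  by apply: bar_exact_full_faithful => x1 x2; exists id.
case: d => [x|]; first exact: exS.
(* The only diagrams under the new object are the strings of C themselves. *)
apply: (@bar_exact_translate k C (adjoin_initial C) adjoin_incl G eta eta_nat
  None y tt (fun x _ => kappa x)) => //.
Qed.

Theorem tor_adjoin_initial (N : cmodule k (adjoin_initial C))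
    (P : proj_resolution (const_module k (opposite C))) n :
  lmod_iso (homology (alt_complex (nerve_tens N)) n)
           (homology (tens_complex (cmod_pull adjoin_incl N) P) n).
Proof.
apply: lmod_iso_trans (nerve_tens_bar N n) _.
apply: (@lmod_iso_trans _ _ (homology (tens_cx N (bar_cx k adjoin_incl)) n)).
  exact: (@tens_comparison k (adjoin_initial C) N
    (bar_cx k (cfunctor_id (adjoin_initial C))) (bar_cx k adjoin_incl)
    _ _ id (fun x => adjoin_incl x)
    (cmod_id (const_module k (opposite (adjoin_initial C))))
    (cmod_id _) (@bar_id_lifts k (adjoin_initial C))
    (@bar_id_exact k (adjoin_initial C))
    (@bar_lifts k _ _ adjoin_incl) bar_incl_exact
    (fun _ _ => erefl) (fun _ _ => erefl) n).
apply: lmod_iso_trans (lmod_iso_sym (change_of_category adjoin_incl N n)) _.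
rewrite -tens_res_cx.
exact: (@tens_comparison k C (cmod_pull adjoin_incl N)
    (bar_cx k (cfunctor_id C)) (res_cx P) _ _ id id
    (cmod_id (const_module k (opposite C)))
    (cmod_id _) (@bar_id_lifts k C) (@bar_id_exact k C)
    (@res_cx_lifts k (opposite C) _ P) (@res_cx_exact k (opposite C) _ P)
    (fun _ _ => erefl) (fun _ _ => erefl) n).
Qed.
End AdjoinInitialTor.

(** * Disjoint union with a point in DeltaS *)

(** The functor [n] |-> [0] * [n] = [n + 1] on [DeltaS], where the added point is 0
    and i in [n] becomes i + 1; the added point is alone in its fibre. *)
Section JoinPoint.

Definition join_lt n m (a : dS_hom n m) : rel 'I_n.+2 := fun i i' =>
  match unlift ord0 i, unlift ord0 i' with
  | Some u, Some u' => dS_lt a u u'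
  | _, _ => false
  end.

Definition join_fun n m (a : dS_hom n m) (i : 'I_n.+2) : 'I_m.+2 :=
  if unlift ord0 i is Some u then lift ord0 (a u) else ord0.

Program Definition dS_join n m (a : dS_hom n m) : dS_hom n.+1 m.+1 :=
  @DSHom n.+1 m.+1 (join_fun a) (join_lt a) _ _ _ _.
Next Obligation.
move=> n m a i i'; rewrite /join_lt /join_fun.
by case: unliftP => [u|] // _; case: unliftP => [u'|] // _ /dS_lt_fib ->.
Qed.
Next Obligation.
by move=> n m a i; rewrite /join_lt; case: unliftP => // u _; rewrite dS_lt_irr.
Qed.
Next Obligation.
move=> n m a i2 i1 i3; rewrite /join_lt.
case: unliftP => [u1|] // _; case: unliftP => [u2|] // _.
by case: unliftP => [u3|] // _; apply: dS_lt_trans.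
Qed.
Next Obligation.
move=> n m a i i'; rewrite /join_lt /join_fun.
case: unliftP => [u|] ->; case: unliftP => [u'|] ->; last by rewrite eqxx.
- by move/lift_inj => au; rewrite (inj_eq lift_inj); apply: dS_lt_total.
- by move/eqP; rewrite eq_sym (negPf (neq_lift _ _)).
- by move/eqP; rewrite (negPf (neq_lift _ _)).
Qed.

Lemma dS_join_id n : dS_join (dS_id n) = dS_id n.+1.
Proof.
apply: dS_hom_eq; apply/funext => i; rewrite /= /join_fun /join_lt.
  by case: unliftP.
by apply/funext => i'; case: unliftP => // u _; case: unliftP.
Qed.

Lemma dS_join_comp n m p (b : dS_hom m p) (a : dS_hom n m) :
  dS_join (dS_comp b a) = dS_comp (dS_join b) (dS_join a).
Proof.
apply: dS_hom_eq; apply/funext => i; rewrite /= /join_fun /join_lt.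
  by case: unliftP => [u|] _; rewrite ?liftK // unlift_none.
apply/funext => i'.
case: (unliftP ord0 i) => [u|] _; case: (unliftP ord0 i') => [u'|] _;
  rewrite ?liftK ?unlift_none ?andbF //.
Qed.

Definition join_functor : cfunctor DeltaS DeltaS :=
  @CFunctor DeltaS DeltaS S (@dS_join) dS_join_id dS_join_comp.

Program Definition dS_inj n m (f : 'I_n.+1 -> 'I_m.+1) (f_inj : injective f) :
    dS_hom n m :=
  @DSHom n m f (fun _ _ => false) _ _ _ _.
Next Obligation. by []. Qed.
Next Obligation. by []. Qed.
Next Obligation. by []. Qed.
Next Obligation. by move=> n m f f_inj i i' /f_inj ->; rewrite eqxx. Qed.

Definition join_inclr n : dS_hom n n.+1 := dS_inj (@lift_inj n.+2 ord0).

Lemma join_inclr_natural n m (a : dS_hom n m) :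
  dS_comp (dS_join a) (join_inclr n) = dS_comp (join_inclr m) a.
Proof.
apply: dS_hom_eq; apply/funext => i; rewrite /= /join_fun /join_lt ?liftK //.
apply/funext => i'; rewrite !liftK andbF orbF.
by apply/esym/andb_idl => /dS_lt_fib ->.
Qed.

Fact point_inj n : injective (fun _ : 'I_1 => ord0 : 'I_n.+1).
Proof. by move=> i i' _; rewrite !ord1. Qed.
Definition join_incll n : dS_hom 0 n.+1 := dS_inj (@point_inj n.+1).

Lemma join_incll_natural n m (a : dS_hom n m) :
  dS_comp (dS_join a) (join_incll n) = join_incll m.
Proof.
apply: dS_hom_eq; apply/funext => i; rewrite /= /join_fun /join_lt unlift_none //.
Qed.
End JoinPoint.

(** * Symmetric homology *)

(** The two functors have convertible values and differ only in the proofs of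
    functoriality. *)
Lemma Bsymplus_pull (k : comPzRingType) (A : kalgebra k) :
  cmod_pull (adjoin_incl DeltaS) (Bsymplus A) = Bsym A.
Proof.
rewrite /cmod_pull /Bsym.
by f_equal; apply: Prop_irrelevance.
Qed.

Theorem theorem53 (k : comPzRingType) (A : kalgebra k) (n : nat) :
  is_HS A n (homology (alt_complex (Yplus A)) n).
Proof.
split=> [|P]; first by exists (bar_resolution k DeltaS).
rewrite -Bsymplus_pull.
exact: (@tor_adjoin_initial k DeltaS join_functor join_inclr join_inclr_natural
  0%N join_incll join_incll_natural).
Qed.
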